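(* Let $(X,d)$ be a complete, doubling, and quasiconvex metric space. Assume that $K\subset X$ is a bounded set with the following property: there exists a constant $C>0$ such that, for every $x\in K$ and $0<r\le\mathrm{diam}(K)$, there is a closed connected set $\Gamma_{x,r}\subset X$ with $\Gamma_{x,r}\supseteq K\cap B_r(x)$ and $\mathcal H^1(\Gamma_{x,r})\le Cr$. Then there exists a (closed) connected set $\Gamma_0\in\mathrm{Reg}_1(C_0)$, with $C_0$ depending only on the doubling and quasiconvexity constants of $(X,d)$ and on $C$, such that $$\Gamma_0\supseteq K\quad\text{and}\quad \mathcal H^1(\Gamma_0)\le C\,\mathrm{diam}(K).$$ Moreover, the set $\Gamma_0$ may be chosen such that $$\mathcal H^1(\Gamma_0)=\min\{\mathcal H^1(\Gamma):\Gamma\text{ closed and connected, and }\Gamma\supseteq K\}.$$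
   Context: $B_r(x)=\{y\in X: d(x,y)<r\}$ denotes the open ball, and $\mathcal H^1$ is the $1$-dimensional Hausdorff measure. $(X,d)$ is quasiconvex with constant $L\ge 1$ if any $x,y\in X$ can be joined by a curve of length at most $L\,d(x,y)$. $(X,d)$ is doubling with constant $D\ge 1$ if for every $\varepsilon\in(0,1/2]$ every subset of $X$ of diameter $r$ can be covered by at most $\varepsilon^{-D}$ sets of diameter at most $\varepsilon r$. A set $E\subset X$ with $\mathrm{diam}(E)>0$ is $1$-regular with constant $C\ge1$, written $E\in\mathrm{Reg}_1(C)$, if it is closed and $C^{-1}r\le\mathcal H^1(B_r(x)\cap E)\le Cr$ for all $x\in E$ and $r\in(0,2\,\mathrm{diam}(E))$.
   Formalization: The formal theorem assumes diam(K) > 0 and asks for the sets Γ_{x,r} for all r > 0, not only r ≤ diam(K); as written the claim fails for a one-point K, and for K = {0,1} in the line with C < 1, because the balls are open. *)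

(* Defs.v *)
From mathcomp Require Import all_boot all_order all_algebra.
From mathcomp Require Import all_classical all_reals all_analysis.
Import Order.TTheory GRing.Theory Num.Theory.
Import numFieldNormedType.Exports.

Set Implicit Arguments.
Unset Strict Implicit.
Unset Printing Implicit Defensive.

Local Open Scope classical_set_scope.
Local Open Scope ring_scope.

Section MetricNotions.
Context {R : realType} {X : metricType R}.

(* The maximum with 0 makes [diam set0 = 0]: [ereal_sup set0] is [-oo]. *)
Definition diam (A : set X) : \bar R :=
  Order.max 0%E (ereal_sup [set (mdist p.1 p.2)%:E | p in A `*` A]).

Definition hausdorff1_pre (delta : R) (A : set X) : \bar R :=
  ereal_inf [set (\sum_(0 <= i <oo) diam (U i))%E | U in
    [set U : nat -> set X | (forall i, (diam (U i) <= delta%:E)%E) /\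
                            A `<=` \bigcup_i U i]].

Definition hausdorff1 (A : set X) : \bar R :=
  ereal_sup [set hausdorff1_pre delta A | delta in [set d : R | 0 < d]].

(* The metric-space analogue of [total_variation]. *)
Definition curve_length (a b : R) (g : R -> X) : \bar R :=
  ereal_sup [set (\sum_(0 <= n < size s)
      mdist (g (nth b (a :: s) n)) (g (nth b (a :: s) n.+1)))%:E
    | s in itv_partition a b].

Definition reg1 (C : R) (E : set X) : Prop :=
  [/\ 1 <= C, (0 < diam E)%E, closed E &
      forall (x : X) (r : R), E x -> 0 < r -> (r%:E < 2%:E * diam E)%E ->
        ((C^-1 * r)%:E <= hausdorff1 (ball x r `&` E))%E /\
        (hausdorff1 (ball x r `&` E) <= (C * r)%:E)%E].

(* The radius ranges over all [0 < r], not only [r <= diam K]. The balls being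
   open, [K `&` ball x (diam K)] may miss points of [K], and the condition for
   [r <= diam K] alone does not imply that a continuum containing [K] has
   length at most [C * diam K]: on the line, [K = {0, 1}] satisfies it for
   every [C > 0], with [Gamma = {x}]. The radii [r > diam K] add exactly that
   the infimum of the lengths of the closed connected sets containing [K] is
   at most [C * diam K]. *)
Definition locally_in_continua (C : R) (K : set X) : Prop :=
  forall (x : X) (r : R), K x -> 0 < r ->
    exists Gamma : set X,
      [/\ closed Gamma, connected Gamma, K `&` ball x r `<=` Gamma &
          (hausdorff1 Gamma <= (C * r)%:E)%E].

End MetricNotions.

(* The axiom of [completeType], which would require a pointed space. *)
Definition complete_space {R : realType} (X : metricType R) : Prop :=
  forall F : set_system X, ProperFilter F -> cauchy F -> exists x : X, F --> x.

Definition quasiconvex {R : realType} (X : metricType R) (L : R) : Prop :=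
  forall x y : X, exists g : R -> X,
    [/\ {within `[0, 1]%classic, continuous g}, g 0 = x, g 1 = y &
        (curve_length 0 1 g <= (L * mdist x y)%:E)%E].

Definition doubling {R : realType} (X : metricType R) (D : R) : Prop :=
  forall (eps r : R) (A : set X), 0 < eps -> eps <= 2^-1 -> diam A = r%:E ->
    exists (n : nat) (U : 'I_n -> set X),
      [/\ n%:R <= eps `^ (- D),
          forall i, (diam (U i) <= (eps * r)%:E)%E &
          A `<=` \bigcup_(i in [set: 'I_n]) U i].

(* Main.v *)
Require Import Defs.
From mathcomp Require Import all_boot all_order all_algebra.
From mathcomp Require Import all_classical all_reals all_analysis.
From mathcomp Require Import measurable_realfun lra.
Import Order.TTheory GRing.Theory Num.Theory.
Import numFieldNormedType.Exports.
Set Implicit Arguments.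
Unset Strict Implicit.
Unset Printing Implicit Defensive.
Local Open Scope classical_set_scope.
Local Open Scope ring_scope.

(** A closed connected set [G] of least length containing [K] exists by Golab's theorem: a
    continuum of length at most [l] splits into boundedly many pieces of small diameter whose
    diameters sum to at most [l], so that length is lower semicontinuous along limits of continua.
    Taking limits along an ultrafilter replaces Blaschke's selection theorem.

    Lower regularity holds for every continuum, the distance to [x] being 1-Lipschitz. For upper
    regularity at a point [x] of [G], let [h r] be the length of [G] in the ball of radius [r].
    Some sphere of radius [s] with [r / 2 < s < r] meets [G] in at most a multiple of [1 + h r / r]
    points. Replacing [G] inside this sphere by a continuum covering [K] there, and joining it to
    the points of the sphere through an [eps r]-net, gives by minimality
    [h (r / 2) <= c r + h r / 4]; iterating from the scale of [diam K] downwards, [h r / r] stays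
    bounded. *)

(** * Elementary properties of the Hausdorff measure *)

(** Hausdorff measure is not lower semicontinuous along arbitrary limits: finite sets approximate a
    segment. For continua the number of pieces is bounded in terms of the length and the mesh alone,
    so an error of [e / N] on each of [N] pieces stays controlled in the limit. Doubling enters
    twice: with completeness it makes bounded sequences converge along ultrafilters, and it bounds
    the size of the nets.

    The nets decide the iteration. Joining each of the [2 (h r + r) / r] sphere points directly to
    [x] costs up to [L r] apiece and would put the factor [2 L] before [h r]. Passing from [h r / r]
    to [h (r / 2) / (r / 2)] doubles this factor, so the iteration closes only for factors below
    [1 / 2]. With a net, only boundedly many representatives pay [L r], the sphere points pay a
    multiple of [eps], and [eps = 1 / (16 L)] brings the factor down to [1 / 4]. *)

Lemma nneseries_le_partial (R : realType) (f : nat -> \bar R) (M : \bar R) :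
  (forall i, 0 <= f i)%E -> (forall n, \sum_(0 <= i < n) f i <= M)%E ->
  (\sum_(0 <= i <oo) f i <= M)%E.
Proof.
move=> f0 fM; apply: lime_le; first exact: is_cvg_nneseries.
by apply: nearW => n; exact: fM.
Qed.

Section HausdorffBasics.
Context {R : realType} {X : metricType R}.
Implicit Types (A B : set X) (U : nat -> set X).
Local Open Scope ereal_scope.

Lemma diam_ge0 A : 0 <= diam A.
Proof. by rewrite /diam le_max lexx. Qed.

Lemma mdist_le_diam A x y : A x -> A y -> (mdist x y)%:E <= diam A.
Proof.
move=> Ax Ay; rewrite /diam le_max; apply/orP; right.
by apply: ereal_sup_ubound; exists (x, y).
Qed.

Lemma diam_le A (M : \bar R) : 0 <= M ->
  (forall x y, A x -> A y -> (mdist x y)%:E <= M) -> diam A <= M.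
Proof.
move=> M0 h; rewrite /diam ge_max M0 /=; apply: ge_ereal_sup.
by move=> _ [[x y] [/= Ax Ay] <-]; apply: h.
Qed.

Lemma le_diam A B : A `<=` B -> diam A <= diam B.
Proof.
move=> AB; apply: diam_le; first exact: diam_ge0.
by move=> x y /AB Bx /AB By; apply: mdist_le_diam.
Qed.

Lemma diam_set0 : diam (set0 : set X) = 0.
Proof. by apply/eqP; rewrite eq_le diam_ge0 andbT; apply: diam_le. Qed.

Lemma diamU_le A B : A `&` B !=set0 -> diam (A `|` B) <= diam A + diam B.
Proof.
move=> [z [Az Bz]]; apply: diam_le; first by rewrite adde_ge0// diam_ge0.
have dA := diam_ge0 A; have dB := diam_ge0 B.
have tr x y : (mdist x y)%:E <= (mdist x z)%:E + (mdist z y)%:E.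
  by rewrite -EFinD lee_fin metric_triangle.
move=> x y [Ax|Bx] [Ay|By].
- by apply: (le_trans (mdist_le_diam Ax Ay)); rewrite leeDl.
- by apply: (le_trans (tr x y)); apply: leeD; apply: mdist_le_diam.
- by apply: (le_trans (tr x y)); rewrite addeC; apply: leeD; apply: mdist_le_diam.
- by apply: (le_trans (mdist_le_diam Bx By)); rewrite leeDr.
Qed.

Lemma hausdorff1_pre_le (delta : R) A U : (forall i, diam (U i) <= delta%:E) ->
  A `<=` \bigcup_i U i ->
  hausdorff1_pre delta A <= \sum_(0 <= i <oo) diam (U i).
Proof. by move=> dU AU; apply: ereal_inf_lbound; exists U. Qed.

Lemma hausdorff1_pre_ge0 (delta : R) A : 0 <= hausdorff1_pre delta A.
Proof.
by apply: le_ereal_inf_tmp => _ [U _ <-]; apply: nneseries_ge0 => ? *; apply: diam_ge0.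
Qed.

Lemma hausdorff1_cover A (delta e : R) : (0 < delta)%R -> (0 < e)%R ->
  hausdorff1 A < +oo ->
  exists U, [/\ forall i, diam (U i) <= delta%:E, A `<=` \bigcup_i U i &
    \sum_(0 <= i <oo) diam (U i) <= hausdorff1 A + e%:E].
Proof.
move=> d0 e0 Aoo; have : hausdorff1_pre delta A < hausdorff1 A + e%:E.
  apply: (@le_lt_trans _ _ (hausdorff1 A)).
    by apply: ereal_sup_ubound; exists delta.
  rewrite lteDl ?lte_fin// ge0_fin_numE//.
  apply: (le_trans (hausdorff1_pre_ge0 1 A)).
  by apply: ereal_sup_ubound; exists 1%R => //=.
by move/ereal_inf_lt => [_ [U [dU AU] <-] /ltW UM]; exists U.
Qed.

Lemma hausdorff1_le A (M : \bar R) :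
  (forall delta : R, (0 < delta)%R -> hausdorff1_pre delta A <= M) ->
  hausdorff1 A <= M.
Proof. by move=> h; apply: ge_ereal_sup => _ [d d0 <-]; apply: h. Qed.

Lemma hausdorff1_ge0 A : 0 <= hausdorff1 A.
Proof.
apply: (le_trans (hausdorff1_pre_ge0 1 A)).
by apply: ereal_sup_ubound; exists 1%R => //=.
Qed.

Lemma le_hausdorff1 A B : A `<=` B -> hausdorff1 A <= hausdorff1 B.
Proof.
move=> AB; apply: hausdorff1_le => d d0.
have : hausdorff1_pre d A <= hausdorff1_pre d B.
  apply: le_ereal_inf_tmp => _ [U [dU BU] <-]; apply: hausdorff1_pre_le => //.
  exact: subset_trans BU.
by move/le_trans; apply; apply: ereal_sup_ubound; exists d.
Qed.

Lemma hausdorff1U A B : hausdorff1 (A `|` B) <= hausdorff1 A + hausdorff1 B.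
Proof.
have [->|] := eqVneq (hausdorff1 A) +oo.
  by rewrite addye ?leey// gt_eqF// (lt_le_trans _ (hausdorff1_ge0 B)) ?ltNy0.
rewrite -ltey => Aoo.
have [->|] := eqVneq (hausdorff1 B) +oo.
  by rewrite addey ?leey// gt_eqF// (lt_le_trans _ (hausdorff1_ge0 A)) ?ltNy0.
rewrite -ltey => Boo.
apply: hausdorff1_le => d d0; apply/lee_addgt0Pr => e e0.
have e20 : (0 < e / 2)%R by rewrite divr_gt0.
have [U [dU AU sU]] := hausdorff1_cover d0 e20 Aoo.
have [W [dW BW sW]] := hausdorff1_cover d0 e20 Boo.
pose V n := if odd n then W n./2 else U n./2.
have dV i : diam (V i) <= d%:E by rewrite /V; case: ifP.
have ABV : A `|` B `<=` \bigcup_i V i.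
  move=> x [/AU [i _ Uix]|/BW [i _ Wix]].
    by exists i.*2 => //; rewrite /V odd_double doubleK.
  by exists i.*2.+1 => //; rewrite /V /= odd_double /= uphalf_double.
apply: (le_trans (hausdorff1_pre_le dV ABV)).
apply: (@le_trans _ _ ((hausdorff1 A + (e / 2)%:E) + (hausdorff1 B + (e / 2)%:E))); last first.
  by rewrite addeACA -EFinD -splitr.
apply: (le_trans _ (leeD sU sW)).
apply: nneseries_le_partial => [i|n]; first exact: diam_ge0.
apply: (@le_trans _ _ (\sum_(0 <= i < n.*2) diam (V i))).
  by apply: lee_sum_nneg_natr; [move=> *; exact: diam_ge0 | rewrite -addnn leq_addr].
have -> : \sum_(0 <= i < n.*2) diam (V i) =
    \sum_(0 <= i < n) diam (U i) + \sum_(0 <= i < n) diam (W i).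
  elim: n => [|n IHn]; first by rewrite !big_nil adde0.
  rewrite doubleS !big_nat_recr//= IHn /V /= odd_double /= doubleK uphalf_double.
  by rewrite addeACA addeA.
by apply: leeD; apply: nneseries_lim_ge => *; exact: diam_ge0.
Qed.

(* If [delta] is smaller than the gap [rho], no set of a [delta]-cover meets both [A] and [B]. *)
Lemma hausdorff1_separated A B (rho : R) : (0 < rho)%R ->
  (forall x y, A x -> B y -> (rho <= mdist x y)%R) ->
  hausdorff1 A + hausdorff1 B <= hausdorff1 (A `|` B).
Proof.
move=> rho0 sepAB.
have [->|] := eqVneq (hausdorff1 (A `|` B)) +oo; first by rewrite leey.
rewrite -ltey => ABoo.
have Aoo : hausdorff1 A < +oo.
  by apply: le_lt_trans (le_hausdorff1 (@subsetUl _ A B)) _.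
have Boo : hausdorff1 B < +oo.
  by apply: le_lt_trans (le_hausdorff1 (@subsetUr _ A B)) _.
(* Both measures are suprema over the mesh. Finiteness lets each be isolated in turn, so that
   independent meshes [d1] and [d2] can be fixed. *)
rewrite -leeBrDr ?ge0_fin_numE ?hausdorff1_ge0//.
apply: hausdorff1_le => d1 d10.
rewrite leeBrDr ?ge0_fin_numE ?hausdorff1_ge0// addeC.
rewrite -leeBrDr; last first.
  rewrite ge0_fin_numE ?hausdorff1_pre_ge0//.
  by apply: le_lt_trans Aoo; apply: ereal_sup_ubound; exists d1.
apply: hausdorff1_le => d2 d20.
rewrite leeBrDr; last first.
  rewrite ge0_fin_numE ?hausdorff1_pre_ge0//.
  by apply: le_lt_trans Aoo; apply: ereal_sup_ubound; exists d1.
rewrite addeC.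
apply/lee_addgt0Pr => e e0.
pose d := Num.min (rho / 2)%R (Num.min d1 d2).
have d0 : (0 < d)%R by rewrite !lt_min d10 d20 divr_gt0.
have [drho dd1 dd2] : [/\ (d < rho)%R, (d <= d1)%R & (d <= d2)%R].
  split; rewrite /d !(gt_min, ge_min) ?lexx ?orbT//.
  by apply/orP; left; lra.
have [U [dU ABU sU]] := hausdorff1_cover d0 e0 ABoo.
apply: le_trans sU.
have h1 : hausdorff1_pre d1 A <= \sum_(0 <= i <oo) diam (U i `&` A).
  apply: hausdorff1_pre_le => [i|x Ax].
    apply: (le_trans (le_diam (@subIsetl _ _ _))); apply: (le_trans (dU i)).
    by rewrite lee_fin.
  by have [i _ Uix] := ABU x (or_introl Ax); exists i.
have h2 : hausdorff1_pre d2 B <= \sum_(0 <= i <oo) diam (U i `&` B).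
  apply: hausdorff1_pre_le => [i|x Bx].
    apply: (le_trans (le_diam (@subIsetl _ _ _))); apply: (le_trans (dU i)).
    by rewrite lee_fin.
  by have [i _ Uix] := ABU x (or_intror Bx); exists i.
apply: (le_trans (leeD h1 h2)).
rewrite -nneseriesD; [|by move=> *; exact: diam_ge0..].
apply: lee_nneseries => i _; first by rewrite adde_ge0// diam_ge0.
have [->|/set0P[a [Ua Aa]]] := eqVneq (U i `&` A) set0.
  by rewrite diam_set0 add0e le_diam.
have [->|/set0P[b [Ub Bb]]] := eqVneq (U i `&` B) set0.
  by rewrite diam_set0 adde0 le_diam.
exfalso; have := le_trans (mdist_le_diam Ua Ub) (dU i).
by rewrite lee_fin; have := sepAB _ _ Aa Bb; lra.
Qed.

Lemma hausdorff1_pre_fin_le (delta : R) A (N : nat) U : (0 <= delta)%R ->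
  (forall i, (i < N)%N -> diam (U i) <= delta%:E) ->
  (forall x, A x -> exists2 i, (i < N)%N & U i x) ->
  hausdorff1_pre delta A <= \sum_(0 <= i < N) diam (U i).
Proof.
move=> d0 dU AU; pose V i := if (i < N)%N then U i else set0.
have dV i : diam (V i) <= delta%:E.
  by rewrite /V; case: ifP => [/dU//|_]; rewrite diam_set0 lee_fin.
have AV : A `<=` \bigcup_i V i.
  by move=> x /AU [i iN Uix]; exists i => //; rewrite /V iN.
apply: (le_trans (hausdorff1_pre_le dV AV)).
rewrite (nneseries_split 0 N); last by move=> *; exact: diam_ge0.
rewrite add0n [X in _ + X]eseries0; last first.
  by move=> i Ni _; rewrite /V ltnNge Ni /= diam_set0.
rewrite adde0 !big_mkord; apply: lee_sum => i _.
by rewrite /V ltn_ord.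
Qed.
End HausdorffBasics.

(** * 1-Lipschitz functions *)
Lemma limn_einf_ge_near (R : realType) (u : (\bar R)^nat) (M : \bar R) (K : nat) :
  (forall k, (K <= k)%N -> M <= u k)%E -> (M <= limn_einf u)%E.
Proof.
move=> Mu; rewrite limn_einf_lim; apply: lime_ge; first exact: is_cvg_einfs.
exists K => // n /= Kn; apply: le_ereal_inf_tmp => _ [k /= nk <-].
exact/Mu/(leq_trans Kn).
Qed.

Lemma limn_einf_le_near (R : realType) (u : (\bar R)^nat) (M : \bar R) :
  (forall k, u k <= M)%E -> (limn_einf u <= M)%E.
Proof.
move=> uM; rewrite limn_einf_lim; apply: lime_le; first exact: is_cvg_einfs.
apply: nearW => n; apply: le_trans (uM n).
by apply: ereal_inf_lbound; exists n => /=.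
Qed.

Lemma nneseries_ge_seq (R : realType) (f : nat -> \bar R) (q : seq nat) :
  (forall i, 0 <= f i)%E -> uniq q ->
  (\sum_(i <- q) f i <= \sum_(0 <= i <oo) f i)%E.
Proof.
move=> f0 uq; rewrite nneseries_esum//; apply: esum_ge.
exists [set` q]; first by split=> //; exact: finite_seq.
by rewrite -fsbig_seq.
Qed.

(** Nonpositive entries are ignored: the list of all pairwise distances of a finite set contains the
    zeros of the diagonal, and still yields its least gap. *)
Lemma pos_lower_bound (R : realType) (q : seq R) :
  exists2 rho, 0 < rho & forall t, t \in q -> 0 < t -> rho <= t.
Proof.
elim: q => [|u q [rho rho0 qrho]]; first by exists 1.
have [u0|u0] := ltP 0 u; last first.
  exists rho => // t; rewrite inE => /predU1P[-> tu|]; last exact: qrho.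
  by have := lt_le_trans tu u0; rewrite ltxx.
exists (Num.min u rho); first by rewrite lt_min u0.
move=> t; rewrite inE ge_min => /predU1P[->|tq t0]; first by rewrite lexx.
by rewrite (qrho t tq t0) orbT.
Qed.

Section Lipschitz.
Context {R : realType} {X : metricType R}.
Implicit Types (A B U : set X) (f : X -> R).

Definition lipschitz1_on A f := forall x y, A x -> A y -> `|f x - f y| <= mdist x y.

Lemma lipschitz1_mdist A x : lipschitz1_on A (mdist x).
Proof.
move=> y z _ _; rewrite ler_norml; apply/andP; split.
  have := metric_triangle x y z; lra.
by have := metric_triangle x z y; rewrite (metric_sym z y); lra.
Qed.

(** The image of [U] may fail to be measurable; the closed interval from its infimum to its supremum
    is measurable and no longer than [diam U]. *)
Lemma lipschitz1_image_hull U f : lipschitz1_on U f -> (diam U < +oo)%E ->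
  exists J : set R, [/\ measurable J, f @` U `<=` J &
    ((@lebesgue_measure R) J <= diam U)%E].
Proof.
move=> fU Uoo; have [->|/set0P[z Uz]] := eqVneq U set0.
  by exists set0; rewrite image_set0 measure0 diam_set0; split.
have Ufin : diam U \is a fin_num by rewrite ge0_fin_numE// diam_ge0.
have fD x y : U x -> U y -> f x - f y <= fine (diam U).
  move=> Ux Uy; rewrite -lee_fin fineK//; apply: le_trans (mdist_le_diam Ux Uy).
  by rewrite lee_fin (le_trans (ler_norm _))// fU.
pose E := f @` U.
have E0 : E !=set0 by exists (f z), z.
have Eub : has_ubound E.
  by exists (f z + fine (diam U)) => _ [x Ux <-]; have := fD x z Ux Uz; lra.
have Elb : has_lbound E.
  by exists (f z - fine (diam U)) => _ [x Ux <-]; have := fD z x Uz Ux; lra.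
exists `[inf E, sup E]%classic; split=> //.
  by move=> t Et; rewrite /= in_itv/= ge_inf// ub_le_sup.
rewrite lebesgue_measure_itv/= lte_fin; case: ifPn => _; last exact: diam_ge0.
rewrite -EFinD -(fineK Ufin) lee_fin lerBlDr; apply: ge_sup => // _ [x Ux <-].
rewrite addrC -lerBlDr; apply: lb_le_inf => // _ [y Uy <-].
by have := fD x y Ux Uy; lra.
Qed.

(** A cover of [A] is carried by [f] to a cover of the interval by hulls no longer than the
    diameters, and Lebesgue measure is countably subadditive. *)
Lemma hausdorff1_lipschitz1_ge A f (a b : R) : lipschitz1_on A f ->
  (forall t, a < t < b -> exists2 x, A x & f x = t) ->
  ((b - a)%:E <= hausdorff1 A)%E.
Proof.
move=> fA abA; have [ab|ba] := ltP a b; last first.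
  by apply: le_trans (hausdorff1_ge0 A); rewrite lee_fin; lra.
have [->|] := eqVneq (hausdorff1 A) +oo%E; first by rewrite leey.
rewrite -ltey => Aoo; apply/lee_addgt0Pr => e e0.
have [U [dU AU sU]] := hausdorff1_cover ltr01 e0 Aoo.
apply: le_trans sU.
have /choice[J hJ] : forall i, exists J : set R, [/\ measurable J,
    f @` (U i `&` A) `<=` J & ((@lebesgue_measure R) J <= diam (U i))%E].
  move=> i; have UA := le_diam (@subIsetl _ (U i) A).
  have [||J [mJ fJ lJ]] := @lipschitz1_image_hull (U i `&` A) f.
  - by move=> x y [_ Ax] [_ Ay]; exact: fA.
  - by apply: (le_lt_trans UA); apply: (le_lt_trans (dU i)); rewrite ltey.
  by exists J; split=> //; exact: le_trans UA.
have abJ : `]a, b[%classic `<=` \bigcup_i J i.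
  move=> t /=; rewrite in_itv/= => /abA [x Ax <-].
  have [i _ Uix] := AU x Ax; exists i => //.
  by have [_ + _] := hJ i; apply; exists x.
have := @measure_sigma_subadditive _ _ _ (@lebesgue_measure R) _ _
  (fun i => let: And3 m _ _ := hJ i in m) (measurable_itv _) abJ.
rewrite /= lebesgue_measure_itv /= lte_fin ab -EFinD => /le_trans; apply.
by apply: lee_nneseries => // i _; have [] := hJ i.
Qed.

(* Fatou applied to the functions counting the sets of a cover that meet the level set:
   their integral is at most the sum of the diameters. *)
Lemma exists_small_level A f (a b M : R) : lipschitz1_on A f -> a < b ->
  (hausdorff1 A < ((b - a) * M)%:E)%E ->
  exists s, [/\ a < s, s < b & forall p : seq X, uniq p ->
    (forall x, x \in p -> A x /\ f x = s) -> (size p)%:R <= M].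
Proof.
move=> fA ab HM.
have Aoo : (hausdorff1 A < +oo)%E by rewrite (lt_trans HM)// ltey.
have Afin : hausdorff1 A \is a fin_num by rewrite ge0_fin_numE// hausdorff1_ge0.
pose e := ((b - a) * M - fine (hausdorff1 A)) / 2.
have M0 : 0 < M.
  by rewrite -(@pmulr_rgt0 _ (b - a)) ?subr_gt0// -lte_fin (le_lt_trans (hausdorff1_ge0 A)).
have {HM}HM : fine (hausdorff1 A) < (b - a) * M by rewrite -lte_fin fineK.
have e0 : 0 < e by rewrite /e; lra.
have /choice[U hU] : forall k, exists U : nat -> set X,
    [/\ forall i, (diam (U i) <= (k.+1%:R^-1)%:E)%E, A `<=` \bigcup_i U i &
     (\sum_(0 <= i <oo) diam (U i) <= hausdorff1 A + e%:E)%E].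
  by move=> k; apply: hausdorff1_cover.
have /choice[J hJ] : forall ki : nat * nat, exists J : set R, [/\ measurable J,
    f @` (U ki.1 ki.2 `&` A) `<=` J & ((@lebesgue_measure R) J <= diam (U ki.1 ki.2))%E].
  move=> [k i] /=; have UA := le_diam (@subIsetl _ (U k i) A).
  have [dU _ _] := hU k.
  have [||J [mJ fJ lJ]] := @lipschitz1_image_hull (U k i `&` A) f.
  - by move=> x y [_ Ax] [_ Ay]; exact: fA.
  - by apply: (le_lt_trans UA); apply: (le_lt_trans (dU i)); rewrite ltey.
  by exists J; split=> //; exact: le_trans UA.
pose D := `]a, b[%classic : set R.
have mD : measurable D by exact: measurable_itv.
have mJ k i : measurable (J (k, i)) by have [] := hJ (k, i).
pose g (k i : nat) (s : measurableTypeR R) : \bar R := (\1_(J (k, i)) s)%:E.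
have g0 k i s : (0 <= g k i s)%E by rewrite lee_fin.
have mg k i : measurable_fun D (g k i).
  by apply/measurable_EFinP; apply: measurable_indic.
(* Counting the measurable hulls [J (k, i)] that contain [s] bounds from above the number of sets of
   the [k]-th cover that meet the level set of [s]. *)
pose N (k : nat) (s : measurableTypeR R) : \bar R := (\sum_(0 <= i <oo) g k i s)%E.
have N0 k s : (0 <= N k s)%E by apply: nneseries_ge0.
have mN k : measurable_fun D (N k).
  by apply: ge0_emeasurable_sum => // i s Ds; exact: g0.
have iN k : (\int[lebesgue_measure]_(s in D) N k s <= hausdorff1 A + e%:E)%E.
  rewrite integral_nneseries//; last by move=> i; exact: mg.
  have [_ _ sU] := hU k; apply: le_trans sU; apply: lee_nneseries => i _.
    by move=> _; apply: integral_ge0 => s _; exact: g0.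
  rewrite integral_indic//; last exact: mJ.
  have [_ _ lJ] := hJ (k, i).
  apply: le_trans lJ; apply: le_measure.
  - by rewrite inE; apply: measurableI => //; exact: mJ.
  - by rewrite inE; exact: mJ.
  - exact: subIsetl.
apply: contrapT => /forallNP noS.
(* A level set with more than [M] points contains a finite list [p] of that size. Once the mesh is
   below the least gap of [p], its points lie in distinct sets of the cover. *)
have NM s : D s -> (M%:E <= limn_einf (N ^~ s))%E.
  rewrite /D /= in_itv/= => /andP[as_ sb].
  have /existsNP[p] : ~ forall p : seq X, uniq p ->
      (forall x, x \in p -> A x /\ f x = s) -> (size p)%:R <= M.
    by move=> h; apply: (noS s).
  move/not_implyP=> [up] /not_implyP[pA /negP]; rewrite -ltNge => Mp.
  have [rho rho0 prho] : exists2 rho : R, 0 < rho &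
      forall x y, x \in p -> y \in p -> x != y -> rho <= mdist x y.
    have [rho rho0 prho] := pos_lower_bound [seq mdist x y | x <- p, y <- p].
    exists rho => // x y xp yp xy; apply: prho; last by rewrite mdist_gt0.
    by apply/allpairsP; exists (x, y).
  have [K Krho] : exists K : nat, K.+1%:R^-1 < rho.
    by have [K] := ltr_add_invr rho0; rewrite add0r; exists K.
  apply: (@limn_einf_ge_near _ _ _ K) => k Kk.
  apply: (@le_trans _ _ (size p)%:R%:E); first by rewrite lee_fin ltW.
  have [dU AU _] := hU k.
  have /choice[j hj] : forall x, exists i, A x -> U k i x.
    move=> x; have [Ax|nAx] := pselect (A x); last by exists 0%N.
    by have [i _ Ui] := AU x Ax; exists i.
  have uj : uniq [seq j x | x <- p].
    rewrite map_inj_in_uniq// => x y xp yp jxy; apply/eqP; apply: contraT => xy.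
    have [Ax _] := pA x xp; have [Ay _] := pA y yp.
    have := hj y Ay; rewrite -jxy => Uy.
    have := le_trans (mdist_le_diam (hj x Ax) Uy) (dU _).
    rewrite lee_fin leNgt => /negP; case; apply: lt_le_trans (prho x y xp yp xy).
    apply: le_lt_trans Krho; rewrite lef_pV2 ?posrE// ler_nat//.
  apply: le_trans (nneseries_ge_seq (fun i => g0 k i s) uj).
  rewrite big_map big_seq (eq_bigr (fun=> 1%R%:E)); last first.
    move=> x xp; have [Ax fx] := pA x xp; rewrite /g indicE mem_set//.
    by have [_ + _] := hJ (k, j x); apply; exists x => //; split => //; exact: hj.
  by rewrite -big_seq sumEFin lee_fin big_const_seq count_predT iter_addr_0.
have := fatou (@lebesgue_measure R) mD mN (fun k s _ => N0 k s).
apply/negP; rewrite -ltNge.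
apply: (@le_lt_trans _ _ (hausdorff1 A + e%:E)%E).
  exact: limn_einf_le_near.
apply: (@lt_le_trans _ _ ((b - a) * M)%:E).
  by rewrite -(fineK Afin) -EFinD lte_fin /e; lra.
apply: (@le_trans _ _ (\int[lebesgue_measure]_(s in D) (cst M%:E) s)%E).
  have lD : (@lebesgue_measure R) D = (b - a)%:E.
    by rewrite lebesgue_measure_itv/= lte_fin ab -EFinD.
  by rewrite integral_cst// mulrC EFinM -lD; exact: lexx.
apply: ge0_le_integral => //.
- by move=> s _; rewrite lee_fin ltW.
- have -> : (fun s => limn_einf (N ^~ s)) = (fun s => - limn_esup (fun k => - N k s))%E.
    by apply/funext => s; rewrite -limn_einfN; congr limn_einf; apply/funext => k /=; rewrite oppeK.
  apply: measurableT_comp => //; apply: measurable_fun_limn_esup => k.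
  exact: measurableT_comp (mN k).
Qed.
End Lipschitz.

(** * Connectedness and ultralimits *)
(** As [G] is closed, the two parts of a separation are closed in the whole space, which avoids
    relatively open and closed sets. *)
Lemma closed_connectedP (T : topologicalType) (G : set T) : closed G ->
  connected G <-> forall A B, closed A -> closed B -> G = A `|` B ->
    A `&` B = set0 -> A !=set0 -> B = set0.
Proof.
move=> cG; split=> [conG A B cA cB GAB AB0 A0|h B B0 [C oC BC] [D cD BD]].
  have AG : A = G.
    apply: conG => //.
    - exists (~` B); first exact: closed_openC.
      rewrite GAB setIUl setICr setU0; apply/esym/setIidPl.
      exact/disjoints_subset.
    - exists A => //; apply/seteqP; split=> [x Ax|x []//]; split=> //.
      by rewrite GAB; left.
  by rewrite -subset0 -AB0 => x Bx; split => //; rewrite AG GAB; right.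
have GC0 : G `\` C = set0.
  apply: (h (G `&` D) (G `\` C)) => //.
  - exact: closedI.
  - by apply: closedI => //; exact: open_closedC.
  - by rewrite -BD BC setUIDK.
  - by rewrite -BD BC setIDA setIAC setDE -setIA setICr setI0.
  - by rewrite -BD.
by rewrite BC; apply/setIidPl => x Gx; apply: contrapT => Cx; have : (G `\` C) x by []; rewrite GC0.
Qed.

Section MetricTopology.
Context {R : realType} {X : metricType R}.
Implicit Types (A B G : set X).

Lemma open_mdistP A :
  open A <-> forall x, A x -> exists2 e : R, 0 < e & forall y, mdist x y < e -> A y.
Proof.
split=> [oA x Ax|h].
  have : nbhs x A by exact: open_nbhs_nbhs.
  by move=> /nbhs_ballP[e /= e0 eA]; exists e => // y xy; apply: eA; rewrite ballEmdist.
rewrite openE => x /h[e e0 eA]; apply/nbhs_ballP; exists e => //= y.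
by rewrite ballEmdist; exact: eA.
Qed.

Lemma closed_mdistP A :
  closed A <-> forall x, (forall e : R, 0 < e -> exists2 y, A y & mdist x y < e) -> A x.
Proof.
split=> [cA x h|h].
  apply: contrapT => nAx; have /open_mdistP/(_ x nAx)[e e0 eA] := closed_openC cA.
  by have [y Ay /eA] := h e e0.
rewrite -[A]setCK; apply: open_closedC; apply/open_mdistP => x nAx.
apply: contrapT => nh; apply: nAx; apply: h => e e0.
apply: contrapT => ne; apply: nh; exists e => // y xy Ay; apply: ne; by exists y.
Qed.

Lemma open_mdist_lt x (t : R) : open [set y : X | mdist x y < t].
Proof.
apply/open_mdistP => y /= xy; exists (t - mdist x y); first by rewrite subr_gt0.
by move=> z yz; have := metric_triangle x y z; lra.
Qed.

Lemma closed_mdist_le x (t : R) : closed [set y : X | mdist x y <= t].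
Proof.
apply/closed_mdistP => y h /=; rewrite leNgt; apply/negP => ty.
have [z /= xz yz] := h (mdist x y - t) (ltac:(lra)).
by have := metric_triangle x z y; rewrite (metric_sym z y); lra.
Qed.

(** If [A] missed the sphere of radius [t], the open and the closed ball would cut the same part out
    of [A], which would be clopen, contain [x] and miss [y]. *)
Lemma connected_level A x y (t : R) : connected A -> A x -> A y ->
  0 < t -> t < mdist x y -> exists2 z, A z & mdist x z = t.
Proof.
move=> conA Ax Ay t0 ty; apply: contrapT => nz.
have ne z : A z -> mdist x z <= t -> mdist x z < t.
  move=> Az; rewrite le_eqVlt => /predU1P[zt|//]; exfalso; apply: nz; by exists z.
have : A `&` [set z | mdist x z < t] = A.
  apply: conA; first by exists x; split => //=; rewrite mdistxx.
  - by exists [set z | mdist x z < t] => //; exact: open_mdist_lt.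
  - exists [set z | mdist x z <= t]; first exact: closed_mdist_le.
    apply/seteqP; split=> z [Az] /= zt; split=> //=; [exact: ltW|exact: ne].
by move/setIidPl => /(_ y Ay) /=; rewrite ltNge ltW.
Qed.

Lemma mdist_le_hausdorff1 A x y : connected A -> A x -> A y ->
  ((mdist x y)%:E <= hausdorff1 A)%E.
Proof.
move=> conA Ax Ay; rewrite -[mdist x y]subr0.
apply: (@hausdorff1_lipschitz1_ge _ _ _ (mdist x)); first exact: lipschitz1_mdist.
by move=> t /andP[]; exact: connected_level.
Qed.

End MetricTopology.

Section Ultralimits.
Context {R : realType} {X : metricType R}.

(** Relative compactness of bounded sets, with ultrafilters in place of subsequences: one fixed [U]
    makes all bounded sequences converge at once, without diagonal extraction. *)
Definition ultraproper := forall (U : set_system nat) (B : set X) (x : nat -> X),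
  UltraFilter U -> (diam B < +oo)%E -> (forall n, B (x n)) ->
  exists l, forall e : R, 0 < e -> U [set n | mdist l (x n) < e].

Lemma ultra_finite_union T (U : set_system T) (N : nat) (A : 'I_N -> set T) :
  UltraFilter U -> U (\bigcup_(i in [set: 'I_N]) A i) -> exists i, U (A i).
Proof.
move=> UU UA; apply: contrapT => /forallNP nA.
have h i : U (~` A i) by have [/nA|] := in_ultra_setVsetC (A i) UU.
have UP : ProperFilter U by exact: ultra_proper.
have hA : U [set x | forall i, ~ A i x] by exact: filter_forall.
by have [x [[i _ Aix] /(_ i)]] := filter_ex (filterI (F := U) UA hA).
Qed.

(** Among finitely many small sets covering [B], one contains [x n] for [U]-almost all [n]; so the
    image of [U] is a Cauchy filter. *)
Lemma doubling_ultraproper (D : R) : complete_space X -> doubling X D -> ultraproper.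
Proof.
move=> cX dX U B x UU Boo Bx.
have UP : ProperFilter U by exact: ultra_proper.
pose r := fine (diam B).
have rB : diam B = r%:E by rewrite fineK// ge0_fin_numE// diam_ge0.
have r0 : 0 <= r by rewrite -lee_fin -rB diam_ge0.
have [l xl] : exists l : X, x @ U --> l.
  apply: cX; apply: cauchy_exP => e e0.
  (* Doubling requires [eps] at most one half; the other bound makes [eps * r < e], with [r + 1] as
     denominator because [r] may vanish. *)
  pose eps := Num.min 2^-1 (e / 2 / (r + 1)).
  have eps0 : 0 < eps by rewrite lt_min invr_gt0 ltr0n !divr_gt0//; lra.
  have [n [V [_ dV BV]]] := dX eps r B eps0 (ltac:(by rewrite ge_min lexx)) rB.
  have [i Ui] : exists i, U [set k | V i (x k)].
    apply: (@ultra_finite_union _ U n (fun i => [set k | V i (x k)])) => //.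
    by apply: filterS filterT => k _; have [i _ Vi] := BV _ (Bx k); exists i.
  have [k Vk] := filter_ex Ui.
  exists (x k); apply: filterS Ui => m Vm; rewrite ballEmdist /=.
  have := le_trans (mdist_le_diam Vk Vm) (dV i); rewrite lee_fin => /le_lt_trans; apply.
  apply: (@le_lt_trans _ _ (e / 2 / (r + 1) * r)).
    by rewrite ler_wpM2r// ge_min lexx orbT.
  have h : (r + 1)^-1 * r <= 1 by rewrite mulrC ler_pdivrMr; lra.
  by rewrite -mulrA; apply: le_lt_trans (ler_piMr _ h) _; lra.
exists l => e e0; have : U (x @^-1` ball l e) by exact: (xl _ (nbhsx_ballx l _ e0)).
by rewrite ballEmdist.
Qed.

Lemma exists_ultra_nat : exists2 U : set_system nat, UltraFilter U & \oo `<=` U.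
Proof. by have [U [UU sU]] := @ultraFilterLemma nat \oo _; exists U. Qed.

End Ultralimits.
Arguments ultraproper {R} X.

(** * Decomposition of continua *)
Section ContinuumPieces.
Context {R : realType} {X : metricType R}.
Implicit Types (G : set X) (V S P : nat -> set X) (w : nat -> R) (q : seq nat).

(** A spanning tree recorded by its order of construction: every entry but the last meets one
    further down the list, so the head is always a leaf. *)
Fixpoint linked V q : Prop :=
  if q is j :: q' then
    linked V q' /\ (q' = [::] \/ exists2 i, i \in q' & V i `&` V j !=set0)
  else True.

(** Otherwise points [x n] missed by the first [n] sets converge along a nonprincipal [U] to a point
    of [G], and the open set containing this limit captures some [x n] of large index. *)
Lemma ultraproper_finite_cover G V : ultraproper X -> closed G -> (diam G < +oo)%E ->
  (forall i, open (V i)) -> G `<=` \bigcup_i V i ->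
  exists n, forall x, G x -> exists2 i, (i < n)%N & V i x.
Proof.
move=> hX cG Goo oV GV; apply: contrapT => /forallNP h.
have /choice[x hx] : forall n, exists x, G x /\ forall i, (i < n)%N -> ~ V i x.
  move=> n; have := h n; move/existsNP => [x /not_implyP[Gx nV]]; exists x; split=> // i iN Vx.
  by apply: nV; exists i.
have [U UU ooU] := exists_ultra_nat.
have UP : ProperFilter U by exact: ultra_proper.
have [l xl] := hX U G x UU Goo (fun n => (hx n).1).
have Gl : G l.
  move/closed_mdistP : cG; apply => e e0.
  by have [n /= ln] := filter_ex (xl e e0); exists (x n) => //; have [] := hx n.
have [i _ Vil] := GV l Gl.
have [e e0 eV] := (open_mdistP (V i)).1 (oV i) l Vil.
have Ui : U [set n | (i < n)%N] by apply: ooU; exists i.+1.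
have [n [/= ln iN]] := filter_ex (filterI (F := U) (xl e e0) Ui).
by have [_ /(_ i iN)] := hx n; apply; exact: eV.
Qed.

(** The list grows greedily. If it does not yet cover [G] and no remaining set that meets [G]
    touches it, the union of the chosen sets and that of the remaining ones separate [G]. *)
Lemma linked_subcover G V (n : nat) : connected G -> (forall i, open (V i)) ->
  (forall x, G x -> exists2 i, (i < n)%N & V i x) ->
  exists q, [/\ uniq q, {subset q <= iota 0 n}, linked V q,
    forall i, i \in q -> V i !=set0 &
    forall x, G x -> exists2 i, i \in q & V i x].
Proof.
move=> conG oV GV.
have step k : exists q, [/\ uniq q, {subset q <= iota 0 n}, linked V q,
    (forall i, i \in q -> G `&` V i !=set0) &
    size q = k \/ forall x, G x -> exists2 i, i \in q & V i x].
  elim: k => [|k [q [uq qn lq qG [qk|qcov]]]].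
  - by exists [::]; split=> //; left.
  - have [qcov|] := pselect (forall x, G x -> exists2 i, i \in q & V i x).
      by exists q; split=> //; right.
    move/existsNP => [y /not_implyP[Gy qy]].
    suff [j [jn jq Gj qj]] : exists j, [/\ (j < n)%N, j \notin q, G `&` V j !=set0 &
        q = [::] \/ exists2 i, i \in q & V i `&` V j !=set0].
      exists (j :: q); split=> /=.
      - by rewrite jq.
      - by move=> i; rewrite inE => /predU1P[->|/qn//]; rewrite mem_iota.
      - by [].
      - by move=> i; rewrite inE => /predU1P[->|/qG//].
      - by left; rewrite qk.
    have [q0|q0] := eqVneq q [::].
      have [j jn Vj] := GV y Gy; exists j; split=> //; first by rewrite q0.
        by exists y.
      by left.
    apply: contrapT => nj; apply: qy.
    pose B := \bigcup_(i in [set i | i \in q]) V i.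
    pose W := \bigcup_(j in [set j | (j < n)%N /\ j \notin q]) V j.
    have oB : open B by apply: bigcup_open.
    have oW : open W by apply: bigcup_open.
    have GBW : G `&` B `&` W = set0.
      rewrite -subset0 => z [[Gz [i /= iq Vi]] [j /= [jn jq] Vj]].
      apply: nj; exists j; split=> //; first by exists z.
      by right; exists i => //; exists z.
    have GB : G `&` B = G.
      apply: conG.
      - have : exists i, i \in q by case: (q) q0 => // a s _; exists a; rewrite inE eqxx.
        by move=> [i iq]; have [z [Gz Vz]] := qG i iq; exists z; split=> //; exists i.
      - by exists B.
      - exists (~` W); first exact: open_closedC.
        apply/seteqP; split=> z [Gz zB]; split=> //.
          by move=> zW; have : (G `&` B `&` W) z by []; rewrite GBW.
        have [i iN Vi] := GV z Gz; exists i => //=; apply: contrapT => /negP iq.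
        by apply: zB; exists i.
    by move: Gy; rewrite -{1}GB => -[_ [i /= iq Vi]]; exists i.
  - by exists q; split=> //; right.
(* A list of [n + 1] distinct indices below [n] is impossible, so growth must have stopped with a
   cover. *)
have [q [uq qn lq qG [qs|qcov]]] := step n.+1; last first.
  exists q; split=> // i /qG [x [_ Vx]]; by exists x.
by have := uniq_leq_size uq qn; rewrite qs size_iota ltnn.
Qed.

(* The list is consumed from its head, a leaf of the tree formed by the links: a leaf heavier
   than [delta] is split off, a lighter one is merged into a neighbour. *)
Lemma linked_pieces V (delta eta : R) q : 0 < delta -> 0 <= eta ->
  uniq q -> linked V q ->
  forall S w, (forall i, i \in q -> [/\ V i `<=` S i, (diam (V i) <= eta%:E)%E,
    (diam (S i) <= (w i)%:E)%E &
    forall x y, V i x -> S i y -> mdist x y <= delta + eta]) ->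
  (forall i, i \in q -> V i !=set0) ->
  exists N P, [/\ N%:R * delta <= \sum_(i <- q) w i + delta,
    forall i x, i \in q -> S i x -> exists2 k, (k < N)%N & P k x,
    forall k, (k < N)%N -> (diam (P k) <= (2 * (delta + eta))%:E)%E &
    (\sum_(0 <= k < N) diam (P k) <= (\sum_(i <- q) w i)%:E)%E].
Proof.
move=> d0 eta0; elim: q => [|j q IHq] /=.
  move=> _ _ S w _ _; exists 0%N, (fun=> set0).
  by rewrite !big_nil mul0r add0r ltW//; split.
move=> /andP[jq uq] [lq link] S w hS V0.
have [Vj dVj dSj mj] := hS j (mem_head _ _).
have dSj2 : (diam (S j) <= (2 * (delta + eta))%:E)%E.
  have [v Vv] := V0 j (mem_head _ _).
  apply: diam_le; first by rewrite lee_fin; lra.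
  move=> x y Sx Sy; rewrite lee_fin.
  have := metric_triangle x v y; rewrite (metric_sym x v).
  have := mj v x Vv Sx; have := mj v y Vv Sy; lra.
have wj0 : 0 <= w j by rewrite -lee_fin; apply: le_trans dSj; exact: diam_ge0.
have qS i : i \in q -> i \in j :: q by rewrite inE => ->; rewrite orbT.
have hSq i (iq : i \in q) := hS i (qS i iq).
have V0q i (iq : i \in q) := V0 i (qS i iq).
rewrite !big_cons.
have [wd|wd] := lerP delta (w j).
  have [N [P [Nd SP dP sP]]] := IHq uq lq S w hSq V0q.
  exists N.+1, (fun k => if k is k'.+1 then P k' else S j); split.
  - by rewrite -natr1 mulrDl mul1r; lra.
  - move=> i x; rewrite inE => /predU1P[->|iq] Sx; first by exists 0%N.
    by have [k kN Pk] := SP i x iq Sx; exists k.+1.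
  - by case=> [//|k]; exact: dP.
  - by rewrite big_nat_recl//= EFinD; apply: leeD.
(* The very last block may be lighter than [delta]; it accounts for the extra [delta] in the bound
   on the count. *)
case: link => [q0|[i iq Vij]].
  exists 1%N, (fun=> S j); rewrite q0 big_nil addr0 mul1r; split.
  - lra.
  - by move=> i x; rewrite mem_seq1 => /eqP -> Sx; exists 0%N.
  - by [].
  - by rewrite big_nat1.
have ij : j != i by apply: contraNneq jq => ->.
(* [S i] is [V i] with what it has absorbed. The invariant bounds how far [S i] reaches from [V i]:
   an absorbed block has diameter below [delta] and touches [V i], so repeated absorption never
   lengthens the reach beyond [delta + eta]. *)
pose S' k := if k == i then S i `|` S j else S k.
pose w' k := if k == i then w i + w j else w k.
have sw : \sum_(k <- q) w' k = w j + \sum_(k <- q) w k.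
  rewrite (bigD1_seq i)//= [in RHS](bigD1_seq i)//= /w' eqxx.
  rewrite (eq_bigr w) => [|k /negbTE -> //]; lra.
have [||N [P [Nd SP dP sP]]] := IHq uq lq S' w'.
- move=> k kq; have [Vk dVk dSk mk] := hSq k kq; rewrite /S' /w'.
  case: (eqVneq k i) => [ki|//]; subst k; split=> //.
  + by move=> x /Vk; left.
  + have [z [Viz Vjz]] := Vij; rewrite EFinD.
    apply: le_trans (diamU_le _) (leeD dSk dSj).
    by exists z; split; [exact: Vk|exact: Vj].
  + have [z [Viz Vjz]] := Vij.
    move=> x y Vx [Sy|Sy]; first exact: mk.
    have := metric_triangle x z y.
    have := le_trans (mdist_le_diam Vx Viz) dVk.
    have := le_trans (mdist_le_diam (Vj _ Vjz) Sy) dSj.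
    by rewrite !lee_fin; lra.
- exact: V0q.
exists N, P; rewrite sw in Nd sP; split=> //.
move=> k x; rewrite inE => /predU1P[->|kq] Sx.
  by apply: (SP i) => //; rewrite /S' eqxx; right.
by apply: (SP k) => //; rewrite /S'; case: ifP => [/eqP <-|//]; left.
Qed.

(** The number [N0] depends on [M] and [delta] only, so that the pieces of all continua of a
    sequence can be indexed by the same integers. *)
Lemma continuum_pieces G (delta M : R) (N0 : nat) : ultraproper X ->
  closed G -> connected G -> (diam G < +oo)%E -> (hausdorff1 G < M%:E)%E ->
  0 < delta -> M / delta + 1 <= N0%:R ->
  exists P, [/\ forall x, G x -> exists2 k, (k < N0)%N & P k x,
    forall k, (diam (P k) <= (4 * delta)%:E)%E &
    (\sum_(0 <= k < N0) diam (P k) <= M%:E)%E].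
Proof.
move=> hX cG conG Goo GM d0 MN.
have Hoo : (hausdorff1 G < +oo)%E by rewrite (lt_trans GM)// ltey.
have Hfin : hausdorff1 G \is a fin_num by rewrite ge0_fin_numE// hausdorff1_ge0.
have HM : 0 < M - fine (hausdorff1 G) by rewrite subr_gt0 -lte_fin fineK.
(* The slack is spent twice: one [e] on the near-optimal cover, another on enlarging its sets to
   open ones. Being at most [delta], it also keeps the enlarged sets of diameter at most [delta]. *)
pose e := Num.min delta ((M - fine (hausdorff1 G)) / 2).
have e0 : 0 < e by rewrite lt_min d0 divr_gt0.
have ed : e <= delta by rewrite ge_min lexx.
have eM : fine (hausdorff1 G) + e + e <= M.
  have : e <= (M - fine (hausdorff1 G)) / 2 by rewrite ge_min lexx orbT.
  lra.
have d20 : 0 < delta / 2 by lra.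
have [U [dU GU sU]] := hausdorff1_cover d20 e0 Hoo.
pose eps i := e / (2 ^ i.+1)%:R.
have eps0 i : 0 < eps i by rewrite divr_gt0// ltr0n expn_gt0.
have epsd i : eps i <= delta / 2.
  rewrite /eps; apply: (@le_trans _ _ (e / 2)); last by lra.
  rewrite ler_pM2l// lef_pV2 ?posrE ?ltr0n ?expn_gt0//.
  by rewrite ler_nat expnS leq_pmulr// expn_gt0.
pose V i : set X := [set y | exists2 x, U i x & mdist x y < eps i / 2].
have oV i : open (V i).
  apply/open_mdistP => y [x Ux xy]; exists (eps i / 2 - mdist x y); first by rewrite subr_gt0.
  by move=> z yz; exists x => //; have := metric_triangle x y z; lra.
have dV i : (diam (V i) <= diam (U i) + (eps i)%:E)%E.
  apply: diam_le; first by rewrite adde_ge0 ?diam_ge0// lee_fin ltW.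
  move=> y z [y' Uy yy] [z' Uz zz].
  apply: (@le_trans _ _ ((mdist y' z')%:E + (eps i)%:E)%E); last first.
    by rewrite leeD2r// mdist_le_diam.
  rewrite -EFinD lee_fin.
  have := metric_triangle y y' z; have := metric_triangle y' z' z.
  by rewrite (metric_sym y y'); lra.
have Ufin i : diam (U i) \is a fin_num.
  by rewrite ge0_fin_numE ?diam_ge0//; apply: (le_lt_trans (dU i)); rewrite ltey.
have GV : G `<=` \bigcup_i V i.
  move=> x /GU[i _ Ux]; exists i => //; exists x => //.
  by rewrite mdistxx divr_gt0.
have [n GVn] := ultraproper_finite_cover hX cG Goo oV GV.
have [q [uq qn lq V0 Gq]] := linked_subcover conG oV GVn.
pose w i := fine (diam (U i)) + eps i.
have dVw i : (diam (V i) <= (w i)%:E)%E by rewrite EFinD fineK.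
have dVd i : (diam (V i) <= delta%:E)%E.
  apply: (le_trans (dVw i)); rewrite lee_fin /w.
  have : fine (diam (U i)) <= delta / 2 by rewrite -lee_fin fineK.
  have := epsd i; lra.
have sw : \sum_(i <- q) w i <= M.
  rewrite -lee_fin -sumEFin; apply: (@le_trans _ _ (\sum_(0 <= i <oo) (w i)%:E)%E).
    by apply: nneseries_ge_seq => // i; apply: le_trans (dVw i); exact: diam_ge0.
  apply: (@le_trans _ _ (\sum_(0 <= i <oo) (diam (U i) + (e / (2 ^ i.+1)%:R)%:E))%E).
    by apply: lee_nneseries => [i _|i _];
      rewrite /w ?EFinD ?fineK ?lexx ?adde_ge0 ?diam_ge0 ?lee_fin ?ltW.
  apply: (le_trans (epsilon_trick _ _ _)) => [i|//|]; first exact: diam_ge0.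
    exact: ltW.
  apply: (le_trans (leeD2r _ sU)).
  by rewrite -(fineK Hfin) -!EFinD lee_fin.
have [||N [P [Nd VP dP sP]]] := @linked_pieces V delta delta q d0 (ltW d0) uq lq V w.
- move=> i iq; split=> // x y Vx Vy.
  by have := le_trans (mdist_le_diam Vx Vy) (dVd i); rewrite lee_fin; lra.
- exact: V0.
have NN0 : (N <= N0)%N.
  rewrite -(ler_nat R); apply: le_trans MN.
  rewrite -(ler_pM2r d0); apply: (le_trans Nd).
  by rewrite mulrDl mul1r divfK ?gt_eqF//; lra.
exists (fun k => if (k < N)%N then P k else set0); split.
- move=> x /Gq[i iq Vx]; have [k kN Pk] := VP i x iq Vx.
  by exists k; rewrite ?kN// (leq_trans kN).
- move=> k; case: ifP => kN; last by rewrite diam_set0 lee_fin; lra.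
  by apply: (le_trans (dP k kN)); rewrite lee_fin; lra.
- rewrite (@big_cat_nat _ _ _ N)//= [X in (_ + X)%E]big_nat_cond.
  rewrite [X in (_ + X)%E]big1 ?adde0; last first.
    by move=> k; rewrite andbT => /andP[Nk _]; rewrite ltnNge Nk /= diam_set0.
  apply: le_trans (le_trans sP _); last by rewrite lee_fin.
  by rewrite !big_mkord; apply: lee_sum => i _; rewrite ltn_ord.
Qed.

End ContinuumPieces.

(** * Golab's theorem *)
Section Golab.
Context {R : realType} {X : metricType R}.
Implicit Types (A B G : set X) (P : nat -> set X) (U : set_system nat).

Lemma diam_adherent A (e : R) : 0 < e -> (diam A < +oo)%E -> A !=set0 ->
  exists x y, [/\ A x, A y & (diam A <= (mdist x y + e)%:E)%E].
Proof.
move=> e0 Aoo [a Aa]; apply: contrapT => h.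
have Afin : diam A \is a fin_num by rewrite ge0_fin_numE// diam_ge0.
have hA x y : A x -> A y -> mdist x y + e < fine (diam A).
  move=> Ax Ay; rewrite -lte_fin fineK// ltNge; apply/negP => dA.
  by apply: h; exists x, y.
have : (diam A <= (fine (diam A) - e)%:E)%E.
  apply: diam_le; first by rewrite lee_fin; have := hA a a Aa Aa; rewrite mdistxx; lra.
  by move=> x y Ax Ay; rewrite lee_fin; have := hA x y Ax Ay; lra.
by rewrite -{1}(fineK Afin) lee_fin; lra.
Qed.

Lemma diam_closed_ball x (r : R) : 0 <= r ->
  (diam [set y : X | (mdist x y <= r)%R] <= (2 * r)%:E)%E.
Proof.
move=> r0; apply: diam_le; first by rewrite lee_fin; lra.
move=> y z /= xy xz; rewrite lee_fin.
by have := metric_triangle y x z; rewrite (metric_sym y x); lra.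
Qed.

(** The Kuratowski limit along [U]; for an ultrafilter the upper and the lower limit coincide. *)
Definition ulim U P : set X :=
  [set x | forall e : R, 0 < e -> U [set n | exists2 y, P n y & mdist x y < e]].

Context (U : set_system nat) {UU : UltraFilter U} (ooU : \oo `<=` U).

Let UP : ProperFilter U. Proof. exact: ultra_proper. Qed.
Local Existing Instance UP.

Lemma ulim_closed P : closed (ulim U P).
Proof.
apply/closed_mdistP => x h e e0.
have e20 : 0 < e / 2 by lra.
have [z Pz xz] := h (e / 2) e20.
apply: filterS (Pz (e / 2) e20) => n [y Py zy]; exists y => //.
by have := metric_triangle x z y; lra.
Qed.

Lemma diam_ulim P (M : R) : U [set n | (diam (P n) <= M%:E)%E] ->
  (diam (ulim U P) <= M%:E)%E.
Proof.
move=> PM; apply: diam_le.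
  by have [n] := filter_ex PM; apply: le_trans; exact: diam_ge0.
move=> x y Px Py; apply/lee_addgt0Pr => e e0; have e20 : 0 < e / 2 by lra.
have [n [/= PMn [[x' Px' xx] [y' Py' yy]]]] :=
  filter_ex (filterI PM (filterI (Px _ e20) (Py _ e20))).
have := le_trans (mdist_le_diam Px' Py') PMn; rewrite -EFinD !lee_fin.
have := metric_triangle x x' y; have := metric_triangle x' y' y.
rewrite (metric_sym y' y); lra.
Qed.

(** Two almost extremal points of the limit are approximated by points of [P n]. This is where the
    lower semicontinuity of length originates. *)
Lemma ulim_diam_le P (e : R) : 0 < e -> (diam (ulim U P) < +oo)%E ->
  U [set n | (diam (ulim U P) <= diam (P n) + e%:E)%E].
Proof.
move=> e0 Poo; have [->|/set0P ne] := eqVneq (ulim U P) set0.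
  by rewrite diam_set0; apply: filterS filterT => n _ /=; rewrite adde_ge0 ?diam_ge0// lee_fin ltW.
have e20 : 0 < e / 2 by lra.
have e40 : 0 < e / 4 by lra.
have [x [y [Px Py dxy]]] := diam_adherent e20 Poo ne.
apply: filterS (filterI (Px _ e40) (Py _ e40)) => n [[x' Px' xx] [y' Py' yy]].
apply: (le_trans dxy); apply: (@le_trans _ _ ((mdist x' y')%:E + e%:E)%E).
  rewrite -EFinD lee_fin.
  have := metric_triangle x x' y; have := metric_triangle x' y' y.
  rewrite (metric_sym y' y); lra.
by rewrite leeD2r// mdist_le_diam.
Qed.

(** If [x] fails to be in each of the [N] limits, take the least of the failing radii. At this
    radius the ultrafilter selects one index [k]; this needs [N] to be the same for all [n]. *)
Lemma ulim_bigcup P (Q : nat -> nat -> set X) (N : nat) :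
  U [set n | forall x, P n x -> exists2 k, (k < N)%N & Q n k x] ->
  forall x, ulim U P x -> exists2 k, (k < N)%N & ulim U (Q ^~ k) x.
Proof.
move=> PQ x Px; apply: contrapT => nQ.
have /choice[e he] : forall k, exists e : R, 0 < e /\
    ((k < N)%N -> ~ U [set n | exists2 y, Q n k y & mdist x y < e]).
  move=> k; have [kN|kN] := boolP (k < N)%N; last by exists 1.
  have : ~ ulim U (Q ^~ k) x by move=> Qx; apply: nQ; exists k.
  by move/existsNP => [e /not_implyP[e0 he]]; exists e.
have [rho rho0 hrho] := pos_lower_bound [seq e k | k <- iota 0 N].
have [i] : exists i : 'I_N, U [set n | exists2 y, Q n i y & mdist x y < rho].
  apply: (ultra_finite_union UU
    (A := fun i : 'I_N => [set n | exists2 y, Q n i y & mdist x y < rho])).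
  apply: filterS (filterI PQ (Px rho rho0)) => n [/= hn [y Py xy]].
  by have [k kN Qy] := hn y Py; exists (Ordinal kN) => //; exists y.
have [ei0 hi] := he i.
have rhoe : rho <= e i.
  by apply: hrho => //; apply/mapP; exists (i : nat) => //; rewrite mem_iota ltn_ord.
move=> Ui; apply: (hi (ltn_ord i)).
by apply: filterS Ui => n [y Qy xy]; exists y => //; exact: lt_le_trans rhoe.
Qed.

Context (hX : ultraproper X).

(** Pairs of points at distance tending to 0 would converge along [U] to a common point of [A] and
    [B]. *)
Lemma closed_disjoint_gap A B (C : set X) : closed A -> closed B -> A `<=` C -> B `<=` C ->
  (diam C < +oo)%E -> A `&` B = set0 ->
  exists2 rho : R, 0 < rho & forall x y, A x -> B y -> rho <= mdist x y.
Proof.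
move=> cA cB AC BC Coo AB0; apply: contrapT => nr.
have /choice[xy hxy] : forall n, exists xy : X * X,
    [/\ A xy.1, B xy.2 & mdist xy.1 xy.2 < n.+1%:R^-1].
  move=> n; apply: contrapT => h; apply: nr; exists n.+1%:R^-1; first by rewrite invr_gt0.
  move=> x y Ax By; rewrite leNgt; apply/negP => lxy; apply: h; by exists (x, y).
have [|x hx] := hX (x := fun n => (xy n).1) UU Coo; first by move=> n; apply: AC; have [] := hxy n.
have [|y hy] := hX (x := fun n => (xy n).2) UU Coo; first by move=> n; apply: BC; have [] := hxy n.
have Ax : A x.
  move/closed_mdistP : cA; apply => e e0.
  by have [n /= xn] := filter_ex (hx e e0); exists (xy n).1 => //; have [] := hxy n.
have By : B y.
  move/closed_mdistP : cB; apply => e e0.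
  by have [n /= xn] := filter_ex (hy e e0); exists (xy n).2 => //; have [] := hxy n.
suff xy0 : mdist x y = 0.
  have : (A `&` B) y by split=> //; rewrite -(mdist_positivity _ _ xy0).
  by rewrite AB0.
apply/eqP; rewrite eq_le mdist_ge0 andbT; apply/ler_addgt0Pl => e e0; rewrite addr0.
have e30 : 0 < e / 3 by lra.
have [K] := ltr_add_invr e30; rewrite add0r => Ke.
have UK : U [set n | (K <= n)%N] by apply: ooU; exists K.
have [n [/= Kn [xn yn]]] := filter_ex (filterI UK (filterI (hx _ e30) (hy _ e30))).
have [_ _ lxy] := hxy n.
have {}lxy : mdist (xy n).1 (xy n).2 < e / 3.
  apply: (lt_trans lxy); apply: le_lt_trans Ke.
  by rewrite lef_pV2 ?posrE// ler_nat.
have := metric_triangle x (xy n).1 y; have := metric_triangle (xy n).1 (xy n).2 y.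
rewrite (metric_sym (xy n).2 y); lra.
Qed.

Lemma ulim_connected P (C : set X) : closed C -> (diam C < +oo)%E ->
  (forall n, P n `<=` C) -> (forall n, P n !=set0) ->
  (forall n, connected (P n)) -> connected (ulim U P).
Proof.
move=> cC Coo PC P0 conP.
have GC : ulim U P `<=` C.
  move=> x Px; move/closed_mdistP : cC; apply => e e0.
  by have [n [y Py xy]] := filter_ex (Px e e0); exists y => //; exact: PC Py.
apply/(closed_connectedP (@ulim_closed P)) => A B cA cB GAB AB0 [a Aa].
rewrite -subset0 => b Bb.
have AC : A `<=` C by apply: subset_trans GC; rewrite GAB; exact: subsetUl.
have BC : B `<=` C by apply: subset_trans GC; rewrite GAB; exact: subsetUr.
have [rho rho0 gap] := closed_disjoint_gap cA cB AC BC Coo AB0.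
pose r := rho / 3; have r0 : 0 < r by rewrite /r; lra.
pose nb (D : set X) := [set y : X | exists2 x, D x & mdist x y < r].
have onb D : open (nb D).
  apply/open_mdistP => y [x Dx xy]; exists (r - mdist x y); first by rewrite subr_gt0.
  by move=> z yz; exists x => //; have := metric_triangle x y z; lra.
have nbAB : nb A `&` nb B = set0.
  rewrite -subset0 => z [[x Ax xz] [y By yz]].
  have := gap x y Ax By; have := metric_triangle x z y; rewrite (metric_sym z y).
  by rewrite /r in xz yz; lra.
have meets (D : set X) d : D d -> ulim U P d -> U [set n | P n `&` nb D !=set0].
  move=> Dd Pd; apply: filterS (Pd r r0) => n [y Py dy]; exists y; split => //; by exists d.
have Uin : U [set n | P n `<=` nb A `|` nb B].
  (* [x n] is chosen outside the two neighbourhoods whenever [P n] leaves them; its limit lies in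
     [A] or [B], so for [U]-almost all [n] this cannot happen. *)
  have /choice[x hx] : forall n, exists x,
      P n x /\ (~ (P n `<=` nb A `|` nb B) -> ~ (nb A `|` nb B) x).
    move=> n; have [h|h] := pselect (P n `<=` nb A `|` nb B).
      by have [x Px] := P0 n; exists x; split.
    by move/existsNP : (h) => [x /not_implyP[Px nx]]; exists x.
  have [l xl] := hX UU Coo (fun n => PC n _ (hx n).1).
  have : ulim U P l.
    by move=> e e0; apply: filterS (xl e e0) => n /= ln; exists (x n) => //; have [] := hx n.
  rewrite GAB => ABl; apply: filterS (xl r r0) => n /= ln.
  apply: contrapT => /(hx n).2; apply.
  by case: ABl => ?; [left|right]; exists l.
have Pa : ulim U P a by rewrite GAB; left.
have Pb : ulim U P b by rewrite GAB; right.
have [n [/= inn [mA [z [Pz Bz]]]]] :=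
  filter_ex (filterI Uin (filterI (meets _ _ Aa Pa) (meets _ _ Bb Pb))).
have : P n `&` nb A = P n.
  apply: conP => //; first by exists (nb A).
  exists (~` nb B); first exact: open_closedC.
  apply/seteqP; split=> y [Py yA]; split=> //.
    by move=> yB; have : (nb A `&` nb B) y by []; rewrite nbAB.
  by have [//|] := inn y Py.
move=> PA; have : (nb A `&` nb B) z by split=> //; move: Pz; rewrite -PA => -[].
by rewrite nbAB.
Qed.

End Golab.

(* A continuum of length at most [l + e] splits into boundedly many small pieces whose diameters
   sum to at most [l + e]; their ultralimits cover the limit of the continua. *)
Lemma golab (R : realType) (X : metricType R) (G : nat -> set X) (l : R) (x0 : X) :
  ultraproper X -> (forall n, closed (G n)) -> (forall n, connected (G n)) ->
  (forall n, G n x0) -> (forall n, hausdorff1 (G n) <= (l + n.+1%:R^-1)%:E)%E ->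
  exists G0 : set X, [/\ closed G0, connected G0, \bigcap_n G n `<=` G0 &
    (hausdorff1 G0 <= l%:E)%E].
Proof.
move=> hX cG conG Gx0 HG.
have [U UU ooU] := exists_ultra_nat.
have UP : ProperFilter U by exact: ultra_proper.
have inv1 n : n.+1%:R^-1 <= 1 :> R by rewrite invf_le1// ler1n.
(* A continuum through [x0] of length at most [l + 1] stays in this ball, which gives the
   boundedness that ultralimits require. *)
pose C := [set y : X | mdist x0 y <= l + 1].
have cC : closed C by exact: closed_mdist_le.
have GC n : G n `<=` C.
  move=> y Gy; rewrite /C /= -lee_fin; apply: (le_trans (mdist_le_hausdorff1 (conG n) (Gx0 n) Gy)).
  by apply: (le_trans (HG n)); rewrite lee_fin lerD2l.
have l0 : 0 <= l + 1 by have := GC 0%N x0 (Gx0 0%N); rewrite /C /= mdistxx.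
have Coo : (diam C < +oo)%E by apply: (le_lt_trans (diam_closed_ball x0 l0)); rewrite ltey.
have Goo n : (diam (G n) < +oo)%E by apply: le_lt_trans (le_diam (GC n)) Coo.
exists (ulim U G); split.
- exact: ulim_closed.
- by apply: (ulim_connected ooU hX cC Coo) => // n; exists x0.
- move=> x Gx e e0; apply: filterS filterT => n _; exists x; last by rewrite mdistxx.
  exact: Gx.
apply: hausdorff1_le => d d0; apply/lee_addgt0Pr => e e0.
have e20 : 0 < e / 2 by lra.
have d40 : 0 < d / 4 by lra.
have [n0] := ltr_add_invr e20; rewrite add0r => n0e.
(* Pieces of mesh [d / 4] have diameter at most [d]. One half of [e] absorbs the excess of length
   over [l], the other is shared by the [N] limit pieces. *)
pose N := (Num.truncn ((l + e / 2) / (d / 4) + 1)).+1.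
have hN : (l + e / 2) / (d / 4) + 1 <= N%:R by rewrite ltW// truncnS_gt.
have /choice[P hP] : forall n, exists P, (n0 <= n)%N ->
   [/\ forall x, G n x -> exists2 k, (k < N)%N & P k x,
    forall k, (diam (P k) <= (4 * (d / 4))%:E)%E &
    (\sum_(0 <= k < N) diam (P k) <= (l + e / 2)%:E)%E].
  move=> n; have [nn|nn] := boolP (n0 <= n)%N; last by exists (fun=> set0).
  have [|P hP] := @continuum_pieces _ _ (G n) (d / 4) (l + e / 2) N
    hX (cG n) (conG n) (Goo n) _ d40 hN.
    apply: (le_lt_trans (HG n)); rewrite lte_fin ltrD2l; apply: le_lt_trans n0e.
    by rewrite lef_pV2 ?posrE// ler_nat.
  by exists P.
have Un0 : U [set n | (n0 <= n)%N] by apply: ooU; exists n0.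
have dQ k : (diam (ulim U (P ^~ k)) <= d%:E)%E.
  apply: diam_ulim; apply: filterS Un0 => n /hP[_ /(_ k) + _].
  by rewrite mulrCA mulfV ?mulr1// pnatr_eq0.
have Qoo k : (diam (ulim U (P ^~ k)) < +oo)%E by apply: le_lt_trans (dQ k) _; rewrite ltey.
apply: (@le_trans _ _ (\sum_(0 <= k < N) diam (ulim U (P ^~ k)))%E).
  apply: hausdorff1_pre_fin_le => //; first exact: ltW.
  by apply: ulim_bigcup => //; apply: filterS Un0 => n /hP[].
have e'0 : 0 < e / 2 / N%:R by rewrite divr_gt0// ltr0n.
have Uall : U [set n | forall k : 'I_N,
    (diam (ulim U (P ^~ k)) <= diam (P n k) + (e / 2 / N%:R)%:E)%E].
  by apply: filter_forall => k; exact: ulim_diam_le.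
have [n [/= /hP[_ _ sP] hn]] := filter_ex (filterI Un0 Uall).
rewrite big_mkord; apply: (le_trans (lee_sum _ (fun k _ => hn k))).
rewrite big_split /= sumEFin sumr_const card_ord -[_ *+ N]mulr_natr divfK ?pnatr_eq0//.
rewrite -(big_mkord xpredT (fun k => diam (P n k))).
by apply: (le_trans (leeD2r _ sP)); rewrite -EFinD lee_fin; lra.
Qed.

(** * Rectifiable curves *)
Section Curves.
Context {R : realType} {X : metricType R}.
Implicit Types (g : R -> X) (a b c : R) (s t : seq R).

Fixpoint chain_length g a s : R :=
  if s is x :: s' then mdist (g a) (g x) + chain_length g x s' else 0.

Lemma chain_lengthE g a (x0 : R) s :
  \sum_(0 <= n < size s) mdist (g (nth x0 (a :: s) n)) (g (nth x0 (a :: s) n.+1))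
  = chain_length g a s.
Proof.
elim: s a => [|x s IHs] a /=; first by rewrite big_nil.
by rewrite big_nat_recl//= IHs.
Qed.

Lemma chain_length_cat g a s t :
  chain_length g a (s ++ t) = chain_length g a s + chain_length g (last a s) t.
Proof. by elim: s a => [|x s IHs] a /=; rewrite ?add0r// IHs addrA. Qed.

Lemma chain_length_ge0 g a s : 0 <= chain_length g a s.
Proof. by elim: s a => //= x s IHs a; rewrite addr_ge0// mdist_ge0. Qed.

Lemma chain_length_le g a b s : itv_partition a b s ->
  ((chain_length g a s)%:E <= curve_length a b g)%E.
Proof.
by move=> abs; apply: ereal_sup_ubound; exists s => //; rewrite chain_lengthE.
Qed.

Lemma curve_length_ge0 g a b : a < b -> (0 <= curve_length a b g)%E.
Proof.
move=> ab; apply: le_trans (chain_length_le g (s := [:: b]) _).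
  by rewrite lee_fin chain_length_ge0.
exact: itv_partition1.
Qed.

Lemma curve_length_cat g a b c : a < b -> b < c ->
  (curve_length a b g + curve_length b c g <= curve_length a c g)%E.
Proof.
move=> ab bc; have [->|] := eqVneq (curve_length a c g) +oo%E; first by rewrite leey.
rewrite -ltey => acoo.
have acfin : curve_length a c g \is a fin_num.
  by rewrite ge0_fin_numE// curve_length_ge0// (lt_trans ab).
have st s t : itv_partition a b s -> itv_partition b c t ->
    ((chain_length g a s)%:E + (chain_length g b t)%:E <= curve_length a c g)%E.
  move=> abs bct; have := chain_length_le g (itv_partition_cat abs bct).
  by rewrite chain_length_cat EFinD; case: abs => _ /eqP ->.
have sb s : itv_partition a b s ->
    (curve_length b c g <= curve_length a c g - (chain_length g a s)%:E)%E.
  move=> abs; apply: ge_ereal_sup => _ [t bct <-].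
  by rewrite chain_lengthE leeBrDr// addeC st.
have bcfin : curve_length b c g \is a fin_num.
  rewrite ge0_fin_numE ?curve_length_ge0//; apply: le_lt_trans (sb _ (itv_partition1 ab)) _.
  by rewrite ltey; rewrite -(fineK acfin).
rewrite -leeBrDr//; apply: ge_ereal_sup => _ [s abs <-]; rewrite chain_lengthE.
by rewrite leeBrDr// addeC -leeBrDr// sb.
Qed.

Lemma diam_image_le_curve_length g a b : a < b ->
  (diam (g @` `[a, b]) <= curve_length a b g)%E.
Proof.
move=> ab; apply: diam_le; first exact: curve_length_ge0.
move=> _ _ [u + <-] [v + <-].
wlog uv : u v / u <= v.
  move=> h; have [uv|/ltW uv] := lerP u v; first exact: h.
  by move=> hu hv; rewrite metric_sym; exact: h.
rewrite /= !in_itv/= => /andP[au ub] /andP[av vb].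
move: uv; rewrite le_eqVlt => /predU1P[<-|uv].
  by rewrite mdistxx curve_length_ge0.
(* The partition through [u] and [v], with coincident points dropped because partitions are strictly
   increasing. *)
pose s := (if a == u then [::] else [:: u]) ++ (if v == b then [::] else [:: v]) ++ [:: b].
apply: (@le_trans _ _ (chain_length g a s)%:E).
  rewrite lee_fin /s chain_length_cat.
  have -> : last a (if a == u then [::] else [:: u]) = u by case: eqP.
  apply: ler_wpDl; first exact: chain_length_ge0.
  rewrite chain_length_cat; case: (eqVneq v b) => [->|_] /=; first by rewrite add0r addr0.
  by rewrite addr0 lerDl addr0 mdist_ge0.
apply: chain_length_le; rewrite /itv_partition /s.
move: au vb; rewrite !le_eqVlt.
case: (eqVneq a u) => [<-|_] /= in uv *; case: (eqVneq v b) => [<-|_] /= in uv *.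
- by rewrite uv.
- by move=> _ ->; rewrite uv.
- by move=> -> _; rewrite uv.
- by move=> -> ->; rewrite uv.
Qed.

Lemma uniform_within_itv g a b : {within `[a, b], continuous g} ->
  forall e : R, 0 < e -> exists n : nat, forall u v, a <= u <= b -> a <= v <= b ->
    `|u - v| < n.+1%:R^-1 -> mdist (g u) (g v) < e.
Proof.
move=> cg e e0; apply: contrapT => /forallNP h.
have /choice[uv huv] : forall n, exists uv : R * R, [/\ a <= uv.1 <= b, a <= uv.2 <= b,
    `|uv.1 - uv.2| < n.+1%:R^-1 & e <= mdist (g uv.1) (g uv.2)].
  move=> n; have := h n => /existsNP[u /existsNP[v]].
  move/not_implyP => [hu /not_implyP[hv /not_implyP[huv /negP]]].
  by rewrite -leNgt => he; exists (u, v).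
pose F := (fun n => (uv n).1) @ \oo.
have [|p [ip clp]] := @segment_compact R a b F _.
  by exists 0%N => // n _ /=; rewrite in_itv/=; have [] := huv n.
have /subspace_continuousP/(_ p ip) := cg.
have e20 : 0 < e / 2 by lra.
move=> /(_ _ (nbhsx_ballx (g p) _ e20)) /nbhs_ballP[r /= r0 hr].
have {}hr (t : R) : `|p - t| < r -> a <= t <= b -> mdist (g p) (g t) < e / 2.
  by move=> pt abt; have := hr t pt; rewrite /= in_itv/= ballEmdist; apply.
have r20 : 0 < r / 2 by lra.
have [K] := ltr_add_invr r20; rewrite add0r => Kr.
have [|_ [[n /= Kn <-] pn]] :=
  clp [set (uv n).1 | n in [set n | (K <= n)%N]] _ _ (nbhsx_ballx p _ r20).
  by exists K => // n /= Kn; exists n.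
have [abu abv uvn en] := huv n.
have Knr : n.+1%:R^-1 < r / 2 by apply: le_lt_trans Kr; rewrite lef_pV2 ?posrE// ler_nat.
have {}uvn := lt_trans uvn Knr.
have pu : `|p - (uv n).1| < r / 2 := pn.
have h1 : mdist (g p) (g (uv n).1) < e / 2 by apply: hr => //; lra.
have h2 : mdist (g p) (g (uv n).2) < e / 2.
  apply: hr => //; have := ler_normD (p - (uv n).1) ((uv n).1 - (uv n).2).
  by rewrite addrA subrK; lra.
have := metric_triangle (g (uv n).1) (g p) (g (uv n).2).
by rewrite (metric_sym (g (uv n).1) (g p)); lra.
Qed.

(** The images of short subintervals form a fine cover; the diameter of each is at most the length
    of its arc, and the arc lengths sum to at most the whole. *)
Lemma hausdorff1_curve g : {within `[0, 1], continuous g} ->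
  (hausdorff1 (g @` `[0%R, 1%R]) <= curve_length 0 1 g)%E.
Proof.
move=> cg; apply: hausdorff1_le => d d0.
have [n hn] := uniform_within_itv cg d0.
(* Dividing by [n + 2] keeps the steps strictly below the modulus [1 / (n + 1)]. *)
pose t (i : nat) : R := i%:R / n.+2%:R.
have tS i : t i < t i.+1 by rewrite ltr_pM2r ?invr_gt0// ltr_nat.
have t0 i : 0 <= t i by rewrite divr_ge0.
have tle i k : (i <= k)%N -> t i <= t k by move=> ik; rewrite ler_pM2r ?invr_gt0// ler_nat.
have tn : t n.+2 = 1 by rewrite /t divff// pnatr_eq0.
have t00 : t 0%N = 0 by rewrite /t mul0r.
have tSd i : t i.+1 - t i < n.+1%:R^-1.
  by rewrite /t -mulrBl -natrB// subSnn mul1r ltf_pV2 ?posrE// ltr_nat.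
pose V i := g @` `[t i, t i.+1]%classic.
have cov k x : 0 <= x <= t k.+1 -> exists2 i, (i < k.+1)%N & t i <= x <= t i.+1.
  elim: k => [|k IHk] /andP[x0 xk]; first by exists 0%N => //; rewrite t00 x0.
  have [xk'|xk'] := lerP x (t k.+1); last by exists k.+1 => //; rewrite ltW//=.
  by have [|i ik hi] := IHk; [rewrite x0|exists i => //; exact: ltnW].
apply: (@le_trans _ _ (\sum_(0 <= i < n.+2) diam (V i))%E).
  apply: hausdorff1_pre_fin_le; first exact: ltW.
    move=> i iN; apply: diam_le; first by rewrite lee_fin ltW.
    move=> _ _ [u + <-] [v + <-]; rewrite /= !in_itv/= => /andP[iu ui] /andP[iv vi].
    have ti1 : t i.+1 <= 1 by rewrite -tn; exact: tle.
    have ti0 := t0 i; have := tSd i => tSdi.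
    rewrite lee_fin ltW// hn//; try by apply/andP; split; lra.
    by apply: le_lt_trans tSdi; rewrite ler_norml; apply/andP; split; lra.
  move=> _ [x + <-]; rewrite /= in_itv/= => x01.
  by have [|i iN hi] := cov n.+1 x; [rewrite tn|exists i => //; exists x => //; rewrite /= in_itv].
suff h k : (\sum_(0 <= i < k.+1) diam (V i) <= curve_length 0 (t k.+1) g)%E.
  by rewrite -tn; exact: h.
elim: k => [|k IHk].
  by rewrite big_nat1 -t00; apply: diam_image_le_curve_length.
rewrite big_nat_recr//=; apply: le_trans (curve_length_cat _ _ (tS _)).
  by apply: leeD => //; exact: diam_image_le_curve_length.
by rewrite -t00; apply: lt_le_trans (tS _) (tle _ _ _).
Qed.

Lemma quasiconvex_continuum (L : R) x y : quasiconvex X L ->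
  exists T : set X, [/\ closed T, connected T, T x, T y &
    (hausdorff1 T <= (L * mdist x y)%:E)%E].
Proof.
move=> /(_ x y)[g [cg g0 g1 lg]]; exists (g @` `[0, 1]%classic); split.
- apply: compact_closed; first exact: metric_hausdorff.
  by apply: continuous_compact => //; exact: segment_compact.
- by apply: connected_continuous_connected => //; exact: segment_connected.
- by exists 0 => //=; rewrite in_itv/= lexx ler01.
- by exists 1 => //=; rewrite in_itv/= lexx ler01.
- by apply: le_trans lg; exact: hausdorff1_curve.
Qed.

End Curves.

(** * Regularity of minimizers *)
Lemma sum_seq_le (R : realType) (I : eqType) (p : seq I) (F : I -> R) (M : R) :
  (forall i, i \in p -> F i <= M) -> \sum_(i <- p) F i <= (size p)%:R * M.
Proof.
move=> FM; rewrite big_seq (le_trans (ler_sum _ FM))// -big_seq.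
by rewrite big_const_seq count_predT iter_addr_0 mulr_natl.
Qed.

Section Surgery.
Context {R : realType} {X : metricType R}.
Implicit Types (G T K : set X) (x y : X) (p : seq X).

Lemma connected_closed_split T A B : closed T -> connected T -> closed A -> closed B ->
  T `<=` A `|` B -> A `&` B = set0 -> T `<=` A \/ T `<=` B.
Proof.
move=> cT conT cA cB TAB AB0.
have [TA0|/set0P TA] := eqVneq (T `&` A) set0.
  right=> y Ty; have [Ay|//] := TAB y Ty.
  by have : (T `&` A) y by []; rewrite TA0.
left=> y Ty; have [//|By] := TAB y Ty.
suff TB0 : T `&` B = set0 by have : (T `&` B) y by []; rewrite TB0.
apply: ((closed_connectedP cT).1 conT (T `&` A) (T `&` B)) => //.
- exact: closedI.
- exact: closedI.
- by rewrite -setIUr; apply/esym/setIidPl.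
- by rewrite setIACA AB0 setI0.
Qed.

(* No boundary bumping is needed: a clopen part missing [T] would stay off the sphere of radius
   [s], hence would already be clopen in [G]. *)
Lemma surgery_connected G T x (s : R) : closed G -> connected G -> G x -> 0 <= s ->
  closed T -> connected T -> (forall y, G y -> mdist x y = s -> T y) ->
  connected ((G `&` [set y | s <= mdist x y]) `|` T).
Proof.
move=> cG conG Gx s0 cT conT GT.
have cs : closed [set y : X | s <= mdist x y].
  have -> : [set y : X | s <= mdist x y] = ~` [set y | mdist x y < s].
    by apply/seteqP; split=> y /=; rewrite leNgt => /negP.
  exact/open_closedC/open_mdist_lt.
have cG' : closed ((G `&` [set y | s <= mdist x y]) `|` T).
  by apply: closedU => //; exact: closedI.
have key A B : closed A -> closed B -> (G `&` [set y | s <= mdist x y]) `|` T = A `|` B ->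
    A `&` B = set0 -> T `<=` A -> B = set0.
  move=> cA cB GAB AB0 TA.
  have Bs y : B y -> G y /\ s < mdist x y.
    move=> By; have : (A `|` B) y by right.
    rewrite -GAB => -[[Gy /= sy]|/TA Ay]; last by have : (A `&` B) y by []; rewrite AB0.
    split=> //; rewrite lt_neqAle sy andbT; apply/eqP => sE.
    have : (A `&` B) y by split=> //; apply/TA/GT.
    by rewrite AB0.
  apply: ((closed_connectedP cG).1 conG (G `&` ([set y | mdist x y <= s] `|` A)) B) => //.
  - by apply: closedI => //; apply: closedU => //; exact: closed_mdist_le.
  - apply/seteqP; split=> [y Gy|y [[]//|/Bs[]//]].
    have [ys|sy] := lerP (mdist x y) s; first by left; split=> //; left.
    have : (A `|` B) y by rewrite -GAB; left; split => //=; exact: ltW.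
    by move=> [Ay|By]; [left; split=> //; right|right].
  - rewrite -subset0 => y [[Gy [/= ys|Ay]] By]; last by rewrite -AB0.
    by have [_] := Bs y By; rewrite ltNge ys.
  - by exists x; split=> //; left; rewrite /= mdistxx.
apply/(closed_connectedP cG') => A B cA cB GAB AB0 [a Aa].
have TAB : T `<=` A `|` B by rewrite -GAB; exact: subsetUr.
have [TA|TB] := connected_closed_split cT conT cA cB TAB AB0.
  exact: key GAB AB0 TA.
have A0 : A = set0 by apply: (key B A) => //; [rewrite GAB setUC|rewrite setIC].
by rewrite A0 in Aa.
Qed.

(** The anchors [c y] are arbitrary points of [T]: the same attachment serves for reaching the
    centre [x], for joining [x] to the net, and for joining the net to the sphere points. *)
Lemma extend_continuum (L : R) T p (c : X -> X) : quasiconvex X L ->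
  closed T -> connected T -> (forall y, y \in p -> T (c y)) ->
  exists T', [/\ closed T', connected T', T `<=` T', forall y, y \in p -> T' y &
    (hausdorff1 T' <= hausdorff1 T + (\sum_(y <- p) L * mdist (c y) y)%:E)%E].
Proof.
move=> qX cT conT; elim: p => [|y p IHp] Tc.
  by exists T; split=> //; rewrite big_nil adde0.
have [|T' [cT' conT' TT' pT' hT']] := IHp.
  by move=> z zp; apply: Tc; rewrite inE zp orbT.
have [Q [cQ conQ Qc Qy hQ]] := quasiconvex_continuum (c y) y qX.
exists (T' `|` Q); split.
- exact: closedU.
- apply: connectedU => //; exists (c y); split=> //.
  by apply/TT'/Tc; rewrite mem_head.
- by apply: subset_trans TT' _; exact: subsetUl.
- by move=> z; rewrite inE => /predU1P[->|/pT' ?]; [right|left].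
- apply: (le_trans (hausdorff1U _ _)).
  rewrite big_cons EFinD addeCA addeC; exact: leeD.
Qed.

Lemma bounded_size_enum (A : set X) (M : R) :
  (forall p, uniq p -> (forall y, y \in p -> A y) -> (size p)%:R <= M) ->
  exists p, [/\ uniq p, forall y, y \in p -> A y & forall y, A y -> y \in p].
Proof.
move=> hM; apply: contrapT => np.
have step k : exists p, [/\ uniq p, forall y, y \in p -> A y & size p = k].
  elim: k => [|k [p [up pA pk]]]; first by exists [::].
  have [y [Ay yp]] : exists y, A y /\ y \notin p.
    apply: contrapT => ny; apply: np; exists p; split=> // y Ay.
    by apply: contrapT => /negP yp; apply: ny; exists y.
  exists (y :: p); split=> /=; [by rewrite yp| |by rewrite pk].
  by move=> z; rewrite inE => /predU1P[->//|/pA].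
have [p [up pA pk]] := step (Num.truncn M).+1.
have := hM p up pA; rewrite pk leNgt => /negP; apply.
exact: truncnS_gt.
Qed.

(* Points of [p] are joined to one representative per set of a [delta]-net, and only the
   representatives are joined to [x]. *)
Lemma net_continuum (D L eps s : R) T x p : doubling X D -> quasiconvex X L -> 0 <= L ->
  0 < eps <= 2^-1 -> 0 <= s -> closed T -> connected T -> T x ->
  (forall y, y \in p -> mdist x y <= s) ->
  exists T', [/\ closed T', connected T', T `<=` T', forall y, y \in p -> T' y &
    (hausdorff1 T' <= hausdorff1 T +
      (eps `^ (- D) * (L * s) + (size p)%:R * (L * (eps * (2 * s))))%:E)%E].
Proof.
move=> dX qX L0 /andP[e0 e2] s0 cT conT Tx ps.
pose B := [set y : X | mdist x y <= s].
have dB := diam_closed_ball x s0.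
have Bfin : diam B \is a fin_num.
  by rewrite ge0_fin_numE ?diam_ge0//; apply: le_lt_trans dB _; rewrite ltey.
have [n [U [neD dU BU]]] := dX eps (fine (diam B)) B e0 e2 (esym (fineK Bfin)).
have {}dU i : (diam (U i) <= (eps * (2 * s))%:E)%E.
  by apply: (le_trans (dU i)); rewrite lee_fin ler_pM2l// -lee_fin fineK.
(* [None] is the default for points outside [p], as ['I_n] may be empty. *)
have /choice[j hj] : forall y, exists i : option 'I_n, y \in p -> exists2 k, i = Some k & U k y.
  move=> y; have [yp|yp] := boolP (y \in p); last by exists None.
  by have [i _ Ui] := BU y (ps y yp); exists (Some i) => _; exists i.
(* The representative is taken in [p] itself when [U i] meets [p], and is [x] otherwise; either way
   it lies within [s] of [x]. *)
have /choice[rep hrep] : forall i : 'I_n, exists z, mdist x z <= s /\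
    forall y, y \in p -> U i y -> U i z.
  move=> i; have [[y yp Ui]|ny] := pselect (exists2 y, y \in p & U i y).
    by exists y; split=> //; exact: ps.
  by exists x; rewrite mdistxx; split=> // y yp Ui; exfalso; apply: ny; exists y.
have [|T1 [cT1 conT1 TT1 repT1 hT1]] :=
  @extend_continuum L T [seq rep i | i <- enum 'I_n] (fun=> x) qX cT conT; first by [].
pose c y := if j y is Some i then rep i else x.
have cT1c y : y \in p -> T1 (c y).
  move=> yp; rewrite /c; have [k -> _] := hj y yp.
  by apply: repT1; apply: map_f; rewrite mem_enum.
have [T2 [cT2 conT2 T12 pT2 hT2]] := extend_continuum qX cT1 conT1 cT1c.
exists T2; split=> //; first exact: subset_trans T12.
apply: (le_trans hT2); rewrite EFinD addeA; apply: leeD; last first.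
  rewrite lee_fin; apply: sum_seq_le => y yp; rewrite ler_wpM2l// /c.
  have [k -> Uky] := hj y yp; have [_ /(_ y yp Uky) Ukr] := hrep k.
  by rewrite -lee_fin; apply: le_trans (dU k); exact: mdist_le_diam.
apply: (le_trans hT1); rewrite leeD2l// lee_fin big_map.
apply: (@le_trans _ _ (n%:R * (L * s))); last by rewrite ler_wpM2r// mulr_ge0.
rewrite -[n in leRHS](size_enum_ord n); apply: sum_seq_le => i _.
by rewrite ler_wpM2l//; have [] := hrep i.
Qed.

(* The competitor keeps [G] outside a ball whose boundary sphere meets [G] in at most
   [2 (h + r) / r] points, [h] being the length of [G] in the ball of radius [r]; joining these
   points through an [eps r]-net costs a multiple of [r] plus a small multiple of [h]. *)
Lemma minimizer_half_ball (D L C : R) K G x (r : R) : 1 <= L -> 0 <= C ->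
  doubling X D -> quasiconvex X L -> locally_in_continua C K ->
  closed G -> connected G -> K `<=` G -> (hausdorff1 G < +oo)%E ->
  (forall G', closed G' -> connected G' -> K `<=` G' -> (hausdorff1 G <= hausdorff1 G')%E) ->
  G x -> 0 < r ->
  (hausdorff1 (ball x (r / 2) `&` G) <=
    ((2 * C + L + (16 * L)^-1 `^ (- D) * L + 4^-1) * r
      + 4^-1 * fine (hausdorff1 (ball x r `&` G)))%:E)%E.
Proof.
move=> L1 C0 dX qX locK cG conG KG Goo minG Gx r0.
have L0 : 0 < L by exact: lt_le_trans L1.
(* Reaching a sphere point from its representative then costs at most [2 * L * eps * s = s / 8], and
   [M] such points cost at most [(h + r) / 4]. *)
pose eps := (16 * L)^-1.
have eps0 : 0 < eps by rewrite invr_gt0 mulr_gt0.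
have epsL : L * eps = 16^-1.
  by rewrite /eps invfM mulrCA mulfV ?mulr1// gt_eqF.
have eps2 : eps <= 2^-1.
  rewrite /eps lef_pV2 ?posrE ?mulr_gt0//; lra.
pose A := ball x r `&` G.
have Aoo : (hausdorff1 A < +oo)%E by apply: le_lt_trans (le_hausdorff1 (@subIsetr _ _ _)) Goo.
have Afin : hausdorff1 A \is a fin_num by rewrite ge0_fin_numE// hausdorff1_ge0.
pose h := fine (hausdorff1 A).
have h0 : 0 <= h by rewrite fine_ge0// hausdorff1_ge0.
(* On an interval of length [r / 2] this gives the product [h + r], strictly above [h] as the choice
   of the level demands. *)
pose M := 2 * (h + r) / r.
have rM : M * r = 2 * (h + r) by rewrite /M divfK// gt_eqF.
have [|s [rs sr hs]] :=
  @exists_small_level _ _ A (mdist x) (r / 2) r M (lipschitz1_mdist x) (ltac:(lra)).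
  by rewrite -(fineK Afin) lte_fin -/h; lra.
have s0 : 0 < s by lra.
have [p [up pA Ap]] := bounded_size_enum hs.
have pM := hs p up pA.
have [T0 [cT0 conT0 T0x KT0 hT0]] : exists T0 : set X, [/\ closed T0, connected T0, T0 x,
    K `&` ball x s `<=` T0 & (hausdorff1 T0 <= (2 * C * s + L * s)%:E)%E].
  (* The local hypothesis concerns centres in [K], while [x] is only in [G]: if [K] meets the ball,
     it is recentred at a point [y] of [K] with radius [2 s]. Otherwise a curve from [x] to itself,
     of length 0, suffices. *)
  have [[y [Ky xy]]|nK] := pselect (K `&` ball x s !=set0); last first.
    have [Q [cQ conQ Qx _ hQ]] := quasiconvex_continuum x x qX.
    exists Q; split=> //; first by move=> y Ky; exfalso; apply: nK; exists y.
    apply: (le_trans hQ); rewrite lee_fin mdistxx mulr0 addr_ge0// ?mulr_ge0//; exact: ltW.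
  have [Q [cQ conQ KQ hQ]] := locK y (2 * s) Ky (ltac:(lra)).
  have Qy : Q y by apply: KQ; split=> //; apply: ballxx; lra.
  have [z|T0 [cT0 conT0 QT0 xT0 hT0]] :=
    @extend_continuum L Q [:: x] (fun=> y) qX cQ conQ; first by [].
  exists T0; split=> //; first by apply: xT0; rewrite inE.
    move=> z [Kz xz]; apply/QT0/KQ; split=> //.
    move: xy xz; rewrite !ballEmdist /= => xy xz.
    by have := metric_triangle y x z; rewrite (metric_sym y x); lra.
  apply: (le_trans hT0); rewrite big_seq1 EFinD; apply: leeD.
    by apply: (le_trans hQ); rewrite lee_fin; lra.
  rewrite lee_fin ler_pM2l// metric_sym ltW//.
  by move: xy; rewrite ballEmdist.
have ps y : y \in p -> mdist x y <= s by move=> /pA[_ ->].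
have [T [cT conT T0T pT hT]] := net_continuum dX qX (ltW L0) (eps := eps) (s := s)
  (ltac:(by rewrite eps0 eps2)) (ltW s0) cT0 conT0 T0x ps.
have GT y : G y -> mdist x y = s -> T y.
  move=> Gy xy; apply/pT/Ap; split=> //; split=> //.
  by rewrite ballEmdist /= xy.
pose E := G `&` [set y | s <= mdist x y].
have cE : closed E.
  apply: closedI => //.
  have -> : [set y : X | s <= mdist x y] = ~` [set y | mdist x y < s].
    by apply/seteqP; split=> y /=; rewrite leNgt => /negP.
  exact/open_closedC/open_mdist_lt.
have KE : K `<=` E `|` T.
  move=> y Ky; have [sy|ys] := lerP s (mdist x y); first by left; split=> //; exact: KG.
  by right; apply/T0T/KT0; split=> //; rewrite ballEmdist.
have GE : (hausdorff1 G <= hausdorff1 E + hausdorff1 T)%E.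
  apply: le_trans (hausdorff1U _ _); apply: minG => //; first exact: closedU.
  exact: surgery_connected (ltW s0) cT conT GT.
(* The half ball and [E] are separated by [s - r / 2], so their lengths add up; cancelling the
   finite length of [E] against minimality leaves the length of [T]. *)
have sep : (hausdorff1 (ball x (r / 2) `&` G) + hausdorff1 E <= hausdorff1 G)%E.
  apply: (@le_trans _ _ (hausdorff1 ((ball x (r / 2) `&` G) `|` E))); last first.
    by apply: le_hausdorff1 => y [[]|[]].
  apply: (@hausdorff1_separated _ _ _ _ (s - r / 2)); first by lra.
  move=> y z [+ _] [_ /=]; rewrite ballEmdist /= => xy xz.
  by have := metric_triangle x y z; lra.
have Eoo : (hausdorff1 E < +oo)%E by apply: le_lt_trans (le_hausdorff1 (@subIsetl _ _ _)) Goo.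
have Efin : hausdorff1 E \is a fin_num by rewrite ge0_fin_numE// hausdorff1_ge0.
have BT : (hausdorff1 (ball x (r / 2) `&` G) <= hausdorff1 T)%E.
  by rewrite -(leeD2rE _ _ Efin) (le_trans sep)// [leRHS]addeC.
apply: (le_trans BT); apply: (le_trans hT).
apply: (le_trans (leeD2r _ hT0)); rewrite -EFinD lee_fin -/eps -/A -/h.
set nD := eps `^ (- D); have nD0 : 0 <= nD by exact: powR_ge0.
have -> : L * (eps * (2 * s)) = 8^-1 * s by rewrite mulrA epsL; lra.
have h1 : nD * (L * s) <= nD * (L * r) by rewrite ler_wpM2l// ler_pM2l// ltW.
have h2 : (size p)%:R * (8^-1 * s) <= 8^-1 * (M * r).
  rewrite mulrCA ler_pM2l//; apply: ler_pM => //; [exact: ltW|exact: ltW].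
have h3 : C * s <= C * r by rewrite ler_wpM2l// ltW.
have h4 : L * s <= L * r by rewrite ler_pM2l// ltW.
rewrite rM in h2; nra.
Qed.

End Surgery.

(** * Existence of minimizers and their two regularity bounds *)

Section Minimizer.
Context {R : realType} {X : metricType R}.
Implicit Types (G K : set X) (x : X).

Lemma exists_minimizer (C : R) K : ultraproper X -> 0 < C -> K !=set0 -> (diam K < +oo)%E ->
  locally_in_continua C K ->
  exists G, [/\ closed G, connected G, K `<=` G, (hausdorff1 G <= C%:E * diam K)%E &
    forall G', closed G' -> connected G' -> K `<=` G' -> (hausdorff1 G <= hausdorff1 G')%E].
Proof.
move=> hX C0 [x0 Kx0] Koo locK.
have Kfin : diam K \is a fin_num by rewrite ge0_fin_numE// diam_ge0.
pose Cand := [set G : set X | [/\ closed G, connected G & K `<=` G]].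
pose m := ereal_inf [set hausdorff1 G | G in Cand].
have mC : (m <= C%:E * diam K)%E.
  (* Balls are open, so a radius slightly above [diam K] is used to contain [K]; the excess [e / C]
     costs [e]. *)
  apply/lee_addgt0Pr => e e0; have eC : 0 < e / C by rewrite divr_gt0.
  have d0 : 0 <= fine (diam K) by rewrite fine_ge0// diam_ge0.
  have [G [cG conG KG hG]] := locK x0 (fine (diam K) + e / C) Kx0 (ltac:(lra)).
  apply: (@le_trans _ _ (hausdorff1 G)).
    apply: ereal_inf_lbound; exists G => //; split=> // y Ky; apply: KG; split=> //.
    rewrite ballEmdist /=; apply: (@le_lt_trans _ _ (fine (diam K))); last by rewrite ltrDl.
    by rewrite -lee_fin fineK//; exact: mdist_le_diam.
  apply: (le_trans hG); rewrite mulrDr mulrCA divff ?gt_eqF// mulr1.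
  by rewrite EFinD EFinM fineK.
have m0 : (0 <= m)%E by apply: le_ereal_inf_tmp => _ [G _ <-]; exact: hausdorff1_ge0.
have mfin : m \is a fin_num.
  by rewrite ge0_fin_numE//; apply: le_lt_trans mC _; rewrite -(fineK Kfin) -EFinM ltey.
have /choice[G hG] : forall n : nat, exists G, Cand G /\
    (hausdorff1 G <= (fine m + n.+1%:R^-1)%:E)%E.
  move=> n; have n0 : 0 < n.+1%:R^-1 :> R by rewrite invr_gt0.
  have [_ [G CG <-] /ltW] := lb_ereal_inf_adherent n0 mfin.
  by rewrite -/m -{1}(fineK mfin) -EFinD; exists G.
have [|||| G0 [cG0 conG0 GG0 hG0]] := @golab R X G (fine m) x0 hX.
- by move=> n; have [[]] := hG n.
- by move=> n; have [[]] := hG n.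
- by move=> n; have [[_ _ KG] _] := hG n; exact: KG.
- by move=> n; have [] := hG n.
have {}hG0 : (hausdorff1 G0 <= m)%E by rewrite -(fineK mfin).
exists G0; split=> //.
- by move=> y Ky; apply: GG0 => n _; have [[_ _ KG] _] := hG n; exact: KG.
- exact: le_trans mC.
- by move=> G' cG' conG' KG'; apply: (le_trans hG0); apply: ereal_inf_lbound; exists G'.
Qed.

(* The bound [h (r / 2) <= c r + h r / 4] propagates [h r <= (C + 4 c) r] from the scale of
   [diam K] down to all scales. *)
Lemma minimizer_upper_regular (D L C c : R) K G : 1 <= L -> 0 <= C ->
  doubling X D -> quasiconvex X L -> locally_in_continua C K ->
  (0 < diam K)%E -> (diam K < +oo)%E ->
  closed G -> connected G -> K `<=` G -> (hausdorff1 G <= C%:E * diam K)%E ->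
  (forall G', closed G' -> connected G' -> K `<=` G' -> (hausdorff1 G <= hausdorff1 G')%E) ->
  2 * C + L + (16 * L)^-1 `^ (- D) * L + 4^-1 <= c ->
  forall x (r : R), G x -> 0 < r -> (hausdorff1 (ball x r `&` G) <= ((C + 4 * c) * r)%:E)%E.
Proof.
move=> L1 C0 dX qX locK K0 Koo cG conG KG GC minG hc x r Gx r0.
have Kfin : diam K \is a fin_num by rewrite ge0_fin_numE// diam_ge0.
pose d := fine (diam K).
have d0 : 0 < d by rewrite fine_gt0// K0.
have Goo : (hausdorff1 G < +oo)%E.
  by apply: le_lt_trans GC _; rewrite -(fineK Kfin) -EFinM ltey.
have c0 : 0 <= c.
  by apply: le_trans hc; rewrite !addr_ge0// ?mulr_ge0 ?powR_ge0//; lra.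
have Bfin y (t : R) : hausdorff1 (ball y t `&` G) \is a fin_num.
  rewrite ge0_fin_numE ?hausdorff1_ge0//; apply: le_lt_trans Goo.
  exact: le_hausdorff1 (@subIsetr _ _ _).
suff h k (t : R) : 0 < t -> d <= t * 2 ^+ k ->
    (hausdorff1 (ball x t `&` G) <= ((C + 4 * c) * t)%:E)%E.
  (* The number [k] of doublings exceeds [d / r], hence so does [2 ^ k]. *)
  apply: (h (Num.truncn (d / r)).+1 r r0).
  rewrite mulrC -ler_pdivrMr// ltW// (lt_le_trans (truncnS_gt _))//.
  by rewrite -natrX ler_nat ltnW// ltn_expl.
elim: k t => [|k IHk] t t0.
  rewrite expr0 mulr1 => dt.
  apply: (le_trans (le_hausdorff1 (@subIsetr _ _ _))); apply: (le_trans GC).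
  rewrite -(fineK Kfin) -EFinM lee_fin -/d.
  by rewrite mulrDl (le_trans (ler_wpM2l C0 dt))// lerDl !mulr_ge0// ltW.
rewrite exprS mulrA => dt.
have t20 : 0 < t * 2 by lra.
(* A bound with constant [a] at radius [2 t] yields the constant [2 c + a / 2] at radius [t]. The
   fixed point of this map is [4 c], and it sends [C + 4 c] to [C / 2 + 4 c]. *)
have := IHk (t * 2) t20 dt; rewrite -(fineK (Bfin _ _)) lee_fin => ht2.
have := minimizer_half_ball L1 C0 dX qX locK cG conG KG Goo minG Gx t20.
rewrite mulfK ?pnatr_eq0// => /le_trans; apply; rewrite lee_fin.
set b := (_ + 4^-1) in hc *.
have : b * (t * 2) <= c * (t * 2) by rewrite ler_pM2r.
have : 0 <= C * t by rewrite mulr_ge0// ltW.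
nra.
Qed.

(** If [G] stayed within [r / 4] of [x], its diameter would be at most [r / 2]. Hence the distance
    to [x] takes on [G] all values between 0 and [r / 4], at points inside the ball. *)
Lemma connected_lower_regular G x (r : R) : connected G -> G x -> 0 < r ->
  (r%:E < 2%:E * diam G)%E -> ((r / 4)%:E <= hausdorff1 (ball x r `&` G))%E.
Proof.
move=> conG Gx r0 rG.
have [y [Gy xy]] : exists y, G y /\ r / 4 < mdist x y.
  apply: contrapT => ny; move: rG; apply/negP; rewrite -leNgt.
  have : (diam G <= (r / 2)%:E)%E.
    have near y : G y -> mdist x y <= r / 4.
      by move=> Gy; rewrite leNgt; apply/negP => xy; apply: ny; exists y.
    apply: diam_le => [|y z Gy Gz]; first by rewrite lee_fin; lra.
    rewrite lee_fin; have := metric_triangle y x z; rewrite (metric_sym y x).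
    by have := near y Gy; have := near z Gz; lra.
  move=> dG; apply: (@le_trans _ _ (2%:E * (r / 2)%:E)%E).
    by rewrite lee_pmul2l// lte_fin.
  by rewrite -EFinM lee_fin; lra.
rewrite -[r / 4]subr0.
apply: (@hausdorff1_lipschitz1_ge _ _ _ (mdist x)); first exact: lipschitz1_mdist.
move=> t /andP[t0 tr]; have [z Gz xz] := connected_level conG Gx Gy t0 (lt_trans tr xy).
by exists z => //; split=> //; rewrite ballEmdist /= xz; lra.
Qed.

End Minimizer.

Theorem theorem3p1 (R : realType) (D L C : R)
    (hD : 1 <= D) (hL : 1 <= L) (hC : 0 < C) :
  exists C0 : R,
    forall X : metricType R,
      complete_space X -> doubling X D -> quasiconvex X L ->
    forall K : set X,
      (0 < diam K)%E -> (diam K < +oo)%E -> locally_in_continua C K ->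
    exists Gamma0 : set X,
      [/\ connected Gamma0, reg1 C0 Gamma0, K `<=` Gamma0,
          (hausdorff1 Gamma0 <= C%:E * diam K)%E &
          forall Gamma : set X, closed Gamma -> connected Gamma ->
            K `<=` Gamma -> (hausdorff1 Gamma0 <= hausdorff1 Gamma)%E].
Proof.
pose c := 2 * C + L + (16 * L)^-1 `^ (- D) * L + 4^-1.
(* This gives [4 <= C + 4 * c], so that the lower bound [r / 4] suffices for regularity. *)
have c1 : 1 <= c.
  rewrite /c; have : 0 <= (16 * L)^-1 `^ (- D) * L by rewrite mulr_ge0 ?powR_ge0//; lra.
  lra.
exists (C + 4 * c) => X cX dX qX K K0 Koo locK.
have Kne : K !=set0.
  by apply/set0P; apply: contraTneq K0 => ->; rewrite diam_set0 ltxx.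
have [G [cG conG KG GC minG]] := exists_minimizer (doubling_ultraproper cX dX) hC Kne Koo locK.
exists G; split=> //; split=> //.
- lra.
- exact: lt_le_trans K0 (le_diam KG).
- move=> x r Gx r0 rG; split; last first.
    exact: (minimizer_upper_regular hL (ltW hC) dX qX locK K0 Koo cG conG KG GC minG (lexx c)).
  apply: le_trans (connected_lower_regular conG Gx r0 rG).
  rewrite lee_fin [leRHS]mulrC ler_pM2r// lef_pV2 ?posrE; lra.
Qed.
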